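(* Let $m$ be a positive integer and $\mathbf{Q}=(Q_1,\dots,Q_{m-1})\in\mathbb{C}^{m-1}$. For every $(\boldsymbol{\varphi},\boldsymbol{\beta})\in\prod_{i=1}^{m-1}\big(\mathbb{C}[x]_{\mathrm{monic}}^{\langle Q_i\rangle}\times\mathbb{B}^{\langle Q_i\rangle}\big)$, the simple highest weight $U(\mathfrak{sl}_m^{\langle\mathbf{Q}\rangle}[x])$-module $\mathcal{L}(\mathbf{u}^{\langle\mathbf{Q}\rangle}(\boldsymbol{\varphi},\boldsymbol{\beta}))$ of highest weight $\mathbf{u}^{\langle\mathbf{Q}\rangle}(\boldsymbol{\varphi},\boldsymbol{\beta})$ is finite dimensional. For $(\boldsymbol{\varphi},\boldsymbol{\beta}),(\boldsymbol{\varphi}',\boldsymbol{\beta}')\in\prod_{i=1}^{m-1}\big(\mathbb{C}[x]_{\mathrm{monic}}^{\langle Q_i\rangle}\times\mathbb{B}^{\langle Q_i\rangle}\big)$ one has $$\mathcal{L}(\mathbf{u}^{\langle\mathbf{Q}\rangle}(\boldsymbol{\varphi},\boldsymbol{\beta}))\cong\mathcal{L}(\mathbf{u}^{\langle\mathbf{Q}\rangle}(\boldsymbol{\varphi}',\boldsymbol{\beta}'))\iff(\boldsymbol{\varphi},\boldsymbol{\beta})=(\boldsymbol{\varphi}',\boldsymbol{\beta}').$$ Moreover, $$\Big\{\mathcal{L}(\mathbf{u}^{\langle\mathbf{Q}\rangle}(\boldsymbol{\varphi},\boldsymbol{\beta}))\ \Big|\ (\boldsymbol{\varphi},\boldsymbol{\beta})\in\prod_{i=1}^{m-1}\big(\mathbb{C}[x]_{\mathrm{monic}}^{\langle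 Q_i\rangle}\times\mathbb{B}^{\langle Q_i\rangle}\big)\Big\}$$ gives a complete set of isomorphism classes of finite dimensional simple $U(\mathfrak{sl}_m^{\langle\mathbf{Q}\rangle}[x])$-modules.
   Context: **Lie algebra.** $\mathfrak{sl}_m^{\langle\mathbf{Q}\rangle}[x]$ is the Lie algebra over $\mathbb{C}$ with generators $\mathcal{X}_{i,t}^{\pm},\mathcal{J}_{i,t}$ ($1\le i\le m-1$, $t\ge0$) and defining relations (for all indices in range and all $s,t,u\ge0$): (L1) $[\mathcal{J}_{i,s},\mathcal{J}_{j,t}]=0$; (L2) $[\mathcal{J}_{j,s},\mathcal{X}_{i,t}^{\pm}]=\pm a_{ji}\mathcal{X}_{i,s+t}^{\pm}$, where $a_{ji}=2$ if $j=i$, $-1$ if $j=i\pm1$, $0$ otherwise; (L3) $[\mathcal{X}_{i,t}^+,\mathcal{X}_{j,s}^-]=\delta_{ij}(\mathcal{J}_{i,s+t}-Q_i\mathcal{J}_{i,s+t+1})$; (L4) $[\mathcal{X}_{i,t}^{\pm},\mathcal{X}_{j,s}^{\pm}]=0$ if $j\ne i\pm1$; (L5) $[\mathcal{X}_{i,t+1}^+,\mathcal{X}_{i\pm1,s}^+]=[\mathcal{X}_{i,t}^+,\mathcal{X}_{i\pm1,s+1}^+]$ and $[\mathcal{X}_{i,t+1}^-,\mathcal{X}_{i\pm1,s}^-]=[\mathcal{X}_{i,t}^-,\mathcal{X}_{i\pm1,s+1}^-]$; (L6) $[\mathcal{X}_{i,s}^+,[\mathcal{X}_{i,t}^+,\mathcal{X}_{i\pm1,u}^+]]=[\mathcal{X}_{i,s}^-,[\mathcal{X}_{i,t}^-,\mathcal{X}_{i\pm1,u}^-]]=0$.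 $U(\cdot)$ denotes the universal enveloping algebra. **Highest weight modules.** For $\mathbf{u}=(u_{i,t})\in\prod_{i=1}^{m-1}\prod_{t\ge0}\mathbb{C}$, a highest weight module of highest weight $\mathbf{u}$ is a $U(\mathfrak{sl}_m^{\langle\mathbf{Q}\rangle}[x])$-module generated by a nonzero vector $v_0$ with $\mathcal{X}_{i,t}^+v_0=0$ and $\mathcal{J}_{i,t}v_0=u_{i,t}v_0$ for all $i,t$. The Verma module $\mathcal{M}(\mathbf{u})$ is the quotient of $U(\mathfrak{sl}_m^{\langle\mathbf{Q}\rangle}[x])$ by the left ideal generated by all $\mathcal{X}_{i,t}^+$ and all $\mathcal{J}_{i,t}-u_{i,t}$; it has a unique maximal proper submodule $\operatorname{rad}\mathcal{M}(\mathbf{u})$, and $\mathcal{L}(\mathbf{u})=\mathcal{M}(\mathbf{u})/\operatorname{rad}\mathcal{M}(\mathbf{u})$. **Parameters.** For $Q\in\mathbb{C}$: $\mathbb{B}^{\langle Q\rangle}=\{0\}$ if $Q=0$ and $\mathbb{B}^{\langle Q\rangle}=\mathbb{C}$ if $Q\ne0$. $\mathbb{C}[x]_{\mathrm{monic}}^{\langle Q\rangle}$ is the set of all monic polynomials in $\mathbb{C}[x]$ if $Q=0$, and the set of monic polynomials of which $Q^{-1}$ is not a root if $Q\ne0$. For $(\boldsymbol{\varphi},\boldsymbol{\beta})=((\varphi_i,\beta_i))_{1\le i\le m-1}$ with $\varphi_i=(x-\gamma_{i,1})\cdots(x-\gamma_{i,n_i})$, the element $\mathbf{u}^{\langle\mathbf{Q}\rangle}(\boldsymbol{\varphi},\boldsymbol{\beta})\in\prod_{i=1}^{m-1}\prod_{t\ge0}\mathbb{C}$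 has components: $\deg\varphi_i+\beta_i$ if $t=0$; $\gamma_{i,1}^t+\dots+\gamma_{i,n_i}^t$ if $t>0$ and $Q_i=0$; $\gamma_{i,1}^t+\dots+\gamma_{i,n_i}^t+Q_i^{-t}\beta_i$ if $t>0$ and $Q_i\ne0$. *)

(* Defs.v *)
From HB Require Import structures.
From mathcomp Require Import all_boot all_order all_algebra.
From mathcomp Require Import boolp classical_sets reals.
From mathcomp Require Export complex.

Set Implicit Arguments.
Unset Strict Implicit.
Unset Printing Implicit Defensive.

Import GRing.Theory.
Local Open Scope ring_scope.
Local Open Scope quotient_scope.

(** * Lie algebras *)

HB.mixin Record Lmodule_isLie (K : comNzRingType) L of GRing.Lmodule K L := {
  lie_br : L -> L -> L;
  lie_brl : forall (a : K) (x y z : L),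
    lie_br (a *: x + y) z = a *: lie_br x z + lie_br y z;
  lie_brr : forall (a : K) (x y z : L),
    lie_br z (a *: x + y) = a *: lie_br z x + lie_br z y;
  lie_brxx : forall x : L, lie_br x x = 0;
  lie_jacobi : forall x y z : L,
    lie_br x (lie_br y z) + lie_br y (lie_br z x) + lie_br z (lie_br x y) = 0
}.

#[short(type="lieAlgType")]
HB.structure Definition LieAlgebra (K : comNzRingType) :=
  {L of GRing.Lmodule K L & Lmodule_isLie K L}.

Inductive lie_term (K T : Type) : Type :=
  | LGen of T
  | LZero
  | LAdd of lie_term K T & lie_term K T
  | LOpp of lie_term K T
  | LScale of K & lie_term K T
  | LBr of lie_term K T & lie_term K T.
Arguments LGen {K T}.
Arguments LZero {K T}.

(** ** Presentation by generators [T] and relations [rel] (each [rel x y]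
    standing for the relation [x = y]): Lie terms modulo the least congruence
    containing the Lie algebra axioms and [rel]. *)
Section LiePresentation.
Variables (K : comNzRingType) (T : Type).
Variable rel : lie_term K T -> lie_term K T -> Prop.

Local Notation term := (lie_term K T).
Local Notation "x <+> y" := (LAdd x y) (at level 50).
Local Notation "a <*> x" := (LScale a x) (at level 40).
Local Notation "<[ x ; y ]>" := (LBr x y) (at level 0).

Inductive lie_eq : term -> term -> Prop :=
  | lie_eq_rel x y : rel x y -> lie_eq x y
  | lie_eq_refl x : lie_eq x x
  | lie_eq_sym x y : lie_eq x y -> lie_eq y x
  | lie_eq_trans y x z : lie_eq x y -> lie_eq y z -> lie_eq x z
  | lie_eq_add x x' y y' :
      lie_eq x x' -> lie_eq y y' -> lie_eq (x <+> y) (x' <+> y')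
  | lie_eq_opp x x' : lie_eq x x' -> lie_eq (LOpp x) (LOpp x')
  | lie_eq_scale a x x' : lie_eq x x' -> lie_eq (a <*> x) (a <*> x')
  | lie_eq_br x x' y y' :
      lie_eq x x' -> lie_eq y y' -> lie_eq <[x; y]> <[x'; y']>
  | lie_eq_addA x y z : lie_eq (x <+> (y <+> z)) ((x <+> y) <+> z)
  | lie_eq_addC x y : lie_eq (x <+> y) (y <+> x)
  | lie_eq_add0 x : lie_eq (LZero <+> x) x
  | lie_eq_addN x : lie_eq (LOpp x <+> x) LZero
  | lie_eq_scaleA a b x : lie_eq (a <*> (b <*> x)) ((a * b) <*> x)
  | lie_eq_scale1 x : lie_eq (1 <*> x) x
  | lie_eq_scaleDr a x y : lie_eq (a <*> (x <+> y)) ((a <*> x) <+> (a <*> y))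
  | lie_eq_scaleDl a b x : lie_eq ((a + b) <*> x) ((a <*> x) <+> (b <*> x))
  | lie_eq_brl a x y z :
      lie_eq <[(a <*> x) <+> y; z]> ((a <*> <[x; z]>) <+> <[y; z]>)
  | lie_eq_brr a x y z :
      lie_eq <[z; (a <*> x) <+> y]> ((a <*> <[z; x]>) <+> <[z; y]>)
  | lie_eq_brxx x : lie_eq <[x; x]> LZero
  | lie_eq_jacobi x y z :
      lie_eq (<[x; <[y; z]>]> <+> <[y; <[z; x]>]> <+> <[z; <[x; y]>]>) LZero.

HB.instance Definition _ := gen_eqMixin term.
HB.instance Definition _ := gen_choiceMixin term.

Definition lie_eqb (x y : term) : bool := `[< lie_eq x y >].

Lemma lie_eqb_equiv : equiv_class_of lie_eqb.
Proof.
split=> [x|x y|y x z].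
- exact/asboolP/lie_eq_refl.
- by apply/asboolP/asboolP; exact: lie_eq_sym.
- by move=> /asboolP xy /asboolP yz; exact/asboolP/(lie_eq_trans xy).
Qed.

Canonical lie_eqb_equivRel := EquivRelPack lie_eqb_equiv.
Canonical lie_eqb_encModRel := defaultEncModRel lie_eqb.

Definition lie_pres := {eq_quot lie_eqb}.
HB.instance Definition _ := Choice.on lie_pres.
HB.instance Definition _ : EqQuotient term lie_eqb lie_pres :=
  EqQuotient.on lie_pres.

Local Notation pi := (\pi_lie_pres).

Lemma lie_piW (P : lie_pres -> Prop) : (forall x, P (pi x)) -> forall x, P x.
Proof. by move=> Ppi; elim/quotW. Qed.

Lemma lie_piP (x y : term) : lie_eq x y <-> pi x = pi y.
Proof.
split=> [xy|/eqP]; first by apply/eqP; rewrite piE; exact/asboolP.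
by rewrite piE => /asboolP.
Qed.

Lemma lie_reprP (x : term) : lie_eq (repr (pi x)) x.
Proof. by apply/lie_piP; rewrite reprK. Qed.

Definition lie_gen (g : T) : lie_pres := pi (LGen g).

Definition lp_add (x y : lie_pres) := pi (repr x <+> repr y).
Definition lp_opp (x : lie_pres) := pi (LOpp (repr x)).
Definition lp_scale (a : K) (x : lie_pres) := pi (a <*> repr x).
Definition lp_br (x y : lie_pres) := pi <[repr x; repr y]>.

Lemma lp_addE x y : lp_add (pi x) (pi y) = pi (x <+> y).
Proof. by apply/lie_piP/lie_eq_add; exact: lie_reprP. Qed.

Lemma lp_oppE x : lp_opp (pi x) = pi (LOpp x).
Proof. by apply/lie_piP/lie_eq_opp; exact: lie_reprP. Qed.

Lemma lp_scaleE a x : lp_scale a (pi x) = pi (a <*> x).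
Proof. by apply/lie_piP/lie_eq_scale; exact: lie_reprP. Qed.

Lemma lp_brE x y : lp_br (pi x) (pi y) = pi <[x; y]>.
Proof. by apply/lie_piP/lie_eq_br; exact: lie_reprP. Qed.

Let lpE := (lp_addE, lp_oppE, lp_scaleE, lp_brE).

Lemma lp_addA : associative lp_add.
Proof.
by elim/lie_piW=> x; elim/lie_piW=> y; elim/lie_piW=> z; rewrite !lpE;
  apply/lie_piP; exact: lie_eq_addA.
Qed.

Lemma lp_addC : commutative lp_add.
Proof.
by elim/lie_piW=> x; elim/lie_piW=> y; rewrite !lpE; apply/lie_piP; exact: lie_eq_addC.
Qed.

Lemma lp_add0 : left_id (pi LZero) lp_add.
Proof. by elim/lie_piW=> x; rewrite !lpE; apply/lie_piP; exact: lie_eq_add0. Qed.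

Lemma lp_addN : left_inverse (pi LZero) lp_opp lp_add.
Proof. by elim/lie_piW=> x; rewrite !lpE; apply/lie_piP; exact: lie_eq_addN. Qed.

HB.instance Definition _ :=
  GRing.isZmodule.Build lie_pres lp_addA lp_addC lp_add0 lp_addN.

Lemma lp_scaleA a b x : lp_scale a (lp_scale b x) = lp_scale (a * b) x.
Proof.
by elim/lie_piW: x => x; rewrite !lpE; apply/lie_piP; exact: lie_eq_scaleA.
Qed.

Lemma lp_scale1 : left_id 1 lp_scale.
Proof. by elim/lie_piW=> x; rewrite !lpE; apply/lie_piP; exact: lie_eq_scale1. Qed.

Lemma lp_scaleDr : right_distributive lp_scale +%R.
Proof.
move=> a; elim/lie_piW=> x; elim/lie_piW=> y; rewrite /GRing.add /= !lpE.
apply/lie_piP; exact: lie_eq_scaleDr.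
Qed.

Lemma lp_scaleDl x : {morph lp_scale^~ x : a b / a + b}.
Proof.
move=> a b; elim/lie_piW: x => x; rewrite /= [RHS]/GRing.add /= !lpE.
apply/lie_piP; exact: lie_eq_scaleDl.
Qed.

HB.instance Definition _ := GRing.Zmodule_isLmodule.Build K lie_pres
  lp_scaleA lp_scale1 lp_scaleDr lp_scaleDl.

Lemma lie_piD x y : pi (x <+> y) = pi x + pi y.
Proof. by rewrite -lp_addE. Qed.

Lemma lie_piZ a x : pi (a <*> x) = a *: pi x.
Proof. by rewrite -lp_scaleE. Qed.

Lemma lp_brl (a : K) (x y z : lie_pres) :
  lp_br (a *: x + y) z = a *: lp_br x z + lp_br y z.
Proof.
elim/lie_piW: x => x; elim/lie_piW: y => y; elim/lie_piW: z => z.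
rewrite -lie_piZ -lie_piD !lp_brE -lie_piZ -lie_piD.
apply/lie_piP; exact: lie_eq_brl.
Qed.

Lemma lp_brr (a : K) (x y z : lie_pres) :
  lp_br z (a *: x + y) = a *: lp_br z x + lp_br z y.
Proof.
elim/lie_piW: x => x; elim/lie_piW: y => y; elim/lie_piW: z => z.
rewrite -lie_piZ -lie_piD !lp_brE -lie_piZ -lie_piD.
apply/lie_piP; exact: lie_eq_brr.
Qed.

Lemma lp_brxx (x : lie_pres) : lp_br x x = 0.
Proof.
by elim/lie_piW: x => x; rewrite lp_brE; apply/lie_piP; exact: lie_eq_brxx.
Qed.

Lemma lp_jacobi (x y z : lie_pres) :
  lp_br x (lp_br y z) + lp_br y (lp_br z x) + lp_br z (lp_br x y) = 0.
Proof.
elim/lie_piW: x => x; elim/lie_piW: y => y; elim/lie_piW: z => z.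
rewrite !lp_brE -!lie_piD; apply/lie_piP; exact: lie_eq_jacobi.
Qed.

HB.instance Definition _ := Lmodule_isLie.Build K lie_pres
  lp_brl lp_brr lp_brxx lp_jacobi.

End LiePresentation.

(** * Universal enveloping algebras *)

Inductive env_term (K L : Type) : Type :=
  | EIn of L
  | EZero
  | EOne
  | EAdd of env_term K L & env_term K L
  | EOpp of env_term K L
  | EScale of K & env_term K L
  | EMul of env_term K L & env_term K L.
Arguments EIn {K L}.
Arguments EZero {K L}.
Arguments EOne {K L}.

(** The associative unital algebra generated by [L], subject to the linearity
    of the inclusion of [L] and to [[x, y] = x y - y x]. *)
Section Enveloping.
Variables (K : comNzRingType) (L : lieAlgType K).

Local Notation term := (env_term K L).
Local Notation "x <+> y" := (EAdd x y) (at level 50).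
Local Notation "a <*> x" := (EScale a x) (at level 40).
Local Notation "x <.> y" := (EMul x y) (at level 40).

Inductive env_eq : term -> term -> Prop :=
  | env_eq_refl x : env_eq x x
  | env_eq_sym x y : env_eq x y -> env_eq y x
  | env_eq_trans y x z : env_eq x y -> env_eq y z -> env_eq x z
  | env_eq_add x x' y y' :
      env_eq x x' -> env_eq y y' -> env_eq (x <+> y) (x' <+> y')
  | env_eq_opp x x' : env_eq x x' -> env_eq (EOpp x) (EOpp x')
  | env_eq_scale a x x' : env_eq x x' -> env_eq (a <*> x) (a <*> x')
  | env_eq_mul x x' y y' :
      env_eq x x' -> env_eq y y' -> env_eq (x <.> y) (x' <.> y')
  | env_eq_addA x y z : env_eq (x <+> (y <+> z)) ((x <+> y) <+> z)
  | env_eq_addC x y : env_eq (x <+> y) (y <+> x)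
  | env_eq_add0 x : env_eq (EZero <+> x) x
  | env_eq_addN x : env_eq (EOpp x <+> x) EZero
  | env_eq_scaleA a b x : env_eq (a <*> (b <*> x)) ((a * b) <*> x)
  | env_eq_scale1 x : env_eq (1 <*> x) x
  | env_eq_scaleDr a x y : env_eq (a <*> (x <+> y)) ((a <*> x) <+> (a <*> y))
  | env_eq_scaleDl a b x : env_eq ((a + b) <*> x) ((a <*> x) <+> (b <*> x))
  | env_eq_mulA x y z : env_eq (x <.> (y <.> z)) ((x <.> y) <.> z)
  | env_eq_mul1l x : env_eq (EOne <.> x) x
  | env_eq_mul1r x : env_eq (x <.> EOne) x
  | env_eq_mulDl x y z : env_eq ((x <+> y) <.> z) ((x <.> z) <+> (y <.> z))
  | env_eq_mulDr x y z : env_eq (x <.> (y <+> z)) ((x <.> y) <+> (x <.> z))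
  | env_eq_scaleAl a x y : env_eq (a <*> (x <.> y)) ((a <*> x) <.> y)
  | env_eq_scaleAr a x y : env_eq (a <*> (x <.> y)) (x <.> (a <*> y))
  | env_eq_in a (x y : L) : env_eq (EIn (a *: x + y)) ((a <*> EIn x) <+> EIn y)
  | env_eq_br (x y : L) :
      env_eq (EIn (lie_br x y))
             ((EIn x <.> EIn y) <+> EOpp (EIn y <.> EIn x)).

HB.instance Definition _ := gen_eqMixin term.
HB.instance Definition _ := gen_choiceMixin term.

Definition env_eqb (x y : term) : bool := `[< env_eq x y >].

Lemma env_eqb_equiv : equiv_class_of env_eqb.
Proof.
split=> [x|x y|y x z].
- exact/asboolP/env_eq_refl.
- by apply/asboolP/asboolP; exact: env_eq_sym.
- by move=> /asboolP xy /asboolP yz; exact/asboolP/(env_eq_trans xy).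
Qed.

Canonical env_eqb_equivRel := EquivRelPack env_eqb_equiv.
Canonical env_eqb_encModRel := defaultEncModRel env_eqb.

Definition envel := {eq_quot env_eqb}.
HB.instance Definition _ := Choice.on envel.
HB.instance Definition _ : EqQuotient term env_eqb envel := EqQuotient.on envel.

Local Notation pi := (\pi_envel).

Lemma env_piW (P : envel -> Prop) : (forall x, P (pi x)) -> forall x, P x.
Proof. by move=> Ppi; elim/quotW. Qed.

Lemma env_piP (x y : term) : env_eq x y <-> pi x = pi y.
Proof.
split=> [xy|/eqP]; first by apply/eqP; rewrite piE; exact/asboolP.
by rewrite piE => /asboolP.
Qed.

Lemma env_reprP (x : term) : env_eq (repr (pi x)) x.
Proof. by apply/env_piP; rewrite reprK. Qed.

Definition env_in (x : L) : envel := pi (EIn x).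

Definition ev_add (x y : envel) := pi (repr x <+> repr y).
Definition ev_opp (x : envel) := pi (EOpp (repr x)).
Definition ev_scale (a : K) (x : envel) := pi (a <*> repr x).
Definition ev_mul (x y : envel) := pi (repr x <.> repr y).

Lemma ev_addE x y : ev_add (pi x) (pi y) = pi (x <+> y).
Proof. by apply/env_piP/env_eq_add; exact: env_reprP. Qed.

Lemma ev_oppE x : ev_opp (pi x) = pi (EOpp x).
Proof. by apply/env_piP/env_eq_opp; exact: env_reprP. Qed.

Lemma ev_scaleE a x : ev_scale a (pi x) = pi (a <*> x).
Proof. by apply/env_piP/env_eq_scale; exact: env_reprP. Qed.

Lemma ev_mulE x y : ev_mul (pi x) (pi y) = pi (x <.> y).
Proof. by apply/env_piP/env_eq_mul; exact: env_reprP. Qed.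

Let evE := (ev_addE, ev_oppE, ev_scaleE, ev_mulE).

Lemma ev_addA : associative ev_add.
Proof.
by elim/env_piW=> x; elim/env_piW=> y; elim/env_piW=> z; rewrite !evE;
  apply/env_piP; exact: env_eq_addA.
Qed.

Lemma ev_addC : commutative ev_add.
Proof.
by elim/env_piW=> x; elim/env_piW=> y; rewrite !evE; apply/env_piP; exact: env_eq_addC.
Qed.

Lemma ev_add0 : left_id (pi EZero) ev_add.
Proof. by elim/env_piW=> x; rewrite !evE; apply/env_piP; exact: env_eq_add0. Qed.

Lemma ev_addN : left_inverse (pi EZero) ev_opp ev_add.
Proof. by elim/env_piW=> x; rewrite !evE; apply/env_piP; exact: env_eq_addN. Qed.

HB.instance Definition _ :=
  GRing.isZmodule.Build envel ev_addA ev_addC ev_add0 ev_addN.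

Lemma ev_mulA : associative ev_mul.
Proof.
by elim/env_piW=> x; elim/env_piW=> y; elim/env_piW=> z; rewrite !evE;
  apply/env_piP; exact: env_eq_mulA.
Qed.

Lemma ev_mul1l : left_id (pi EOne) ev_mul.
Proof. by elim/env_piW=> x; rewrite !evE; apply/env_piP; exact: env_eq_mul1l. Qed.

Lemma ev_mul1r : right_id (pi EOne) ev_mul.
Proof. by elim/env_piW=> x; rewrite !evE; apply/env_piP; exact: env_eq_mul1r. Qed.

Lemma ev_mulDl : left_distributive ev_mul +%R.
Proof.
elim/env_piW=> x; elim/env_piW=> y; elim/env_piW=> z; rewrite /GRing.add /= !evE.
apply/env_piP; exact: env_eq_mulDl.
Qed.

Lemma ev_mulDr : right_distributive ev_mul +%R.
Proof.
elim/env_piW=> x; elim/env_piW=> y; elim/env_piW=> z; rewrite /GRing.add /= !evE.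
apply/env_piP; exact: env_eq_mulDr.
Qed.

(* The augmentation, killing [L], shows that [envel] is nontrivial. *)
Fixpoint env_aug (x : term) : K :=
  match x with
  | EIn _ => 0
  | EZero => 0
  | EOne => 1
  | EAdd x y => env_aug x + env_aug y
  | EOpp x => - env_aug x
  | EScale a x => a * env_aug x
  | EMul x y => env_aug x * env_aug y
  end.

Lemma env_aug_eq x y : env_eq x y -> env_aug x = env_aug y.
Proof.
elim=> //=.
- by move=> ? ? ? _ -> _ ->.
- by move=> ? ? ? ? _ -> _ ->.
- by move=> ? ? _ ->.
- by move=> ? ? ? _ ->.
- by move=> ? ? ? ? _ -> _ ->.
- by move=> *; rewrite addrA.
- by move=> *; rewrite addrC.
- by move=> *; rewrite add0r.
- by move=> *; rewrite addNr.
- by move=> *; rewrite mulrA.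
- by move=> *; rewrite mul1r.
- by move=> *; rewrite mulrDr.
- by move=> *; rewrite mulrDl.
- by move=> *; rewrite mulrA.
- by move=> *; rewrite mul1r.
- by move=> *; rewrite mulr1.
- by move=> *; rewrite mulrDl.
- by move=> *; rewrite mulrDr.
- by move=> *; rewrite mulrA.
- by move=> *; rewrite mulrCA.
- by move=> *; rewrite mulr0 addr0.
- by move=> *; rewrite mul0r subrr.
Qed.

Lemma ev_1neq0 : pi EOne != 0 :> envel.
Proof.
by apply/eqP => /env_piP /env_aug_eq /= /eqP; rewrite oner_eq0.
Qed.

HB.instance Definition _ := GRing.Zmodule_isNzRing.Build envel
  ev_mulA ev_mul1l ev_mul1r ev_mulDl ev_mulDr ev_1neq0.

Lemma ev_scaleA a b x : ev_scale a (ev_scale b x) = ev_scale (a * b) x.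
Proof.
by elim/env_piW: x => x; rewrite !evE; apply/env_piP; exact: env_eq_scaleA.
Qed.

Lemma ev_scale1 : left_id 1 ev_scale.
Proof. by elim/env_piW=> x; rewrite !evE; apply/env_piP; exact: env_eq_scale1. Qed.

Lemma ev_scaleDr : right_distributive ev_scale +%R.
Proof.
move=> a; elim/env_piW=> x; elim/env_piW=> y; rewrite /GRing.add /= !evE.
apply/env_piP; exact: env_eq_scaleDr.
Qed.

Lemma ev_scaleDl x : {morph ev_scale^~ x : a b / a + b}.
Proof.
move=> a b; elim/env_piW: x => x; rewrite /= [RHS]/GRing.add /= !evE.
apply/env_piP; exact: env_eq_scaleDl.
Qed.

HB.instance Definition _ := GRing.Zmodule_isLmodule.Build K envel
  ev_scaleA ev_scale1 ev_scaleDr ev_scaleDl.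

Lemma ev_scaleAl (a : K) (x y : envel) : a *: (x * y) = (a *: x) * y.
Proof.
elim/env_piW: x => x; elim/env_piW: y => y.
rewrite /GRing.mul /GRing.scale /= !evE; apply/env_piP; exact: env_eq_scaleAl.
Qed.

HB.instance Definition _ := GRing.Lmodule_isLalgebra.Build K envel ev_scaleAl.

Lemma ev_scaleAr (a : K) (x y : envel) : a *: (x * y) = x * (a *: y).
Proof.
elim/env_piW: x => x; elim/env_piW: y => y.
rewrite /GRing.mul /GRing.scale /= !evE; apply/env_piP; exact: env_eq_scaleAr.
Qed.

HB.instance Definition _ := GRing.Lalgebra_isAlgebra.Build K envel ev_scaleAr.

End Enveloping.

(** * Modules over a (noncommutative) ring *)

Section Quotient.
Variables (A : pzRingType) (M : lmodType A) (N : submodClosed M).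

(* [ring_quotient] quotients by a [zmodClosed] predicate. *)
Definition submod_zmod : {pred M} := fun x => x \in N.

Lemma submod_zmod_closed : zmod_closed submod_zmod.
Proof. exact: GRing.submod_closedB (submodClosedP N). Qed.

HB.instance Definition _ := GRing.isZmodClosed.Build M submod_zmod
  submod_zmod_closed.

Definition quotmod := {ideal_quot submod_zmod}.
HB.instance Definition _ := GRing.Zmodule.on quotmod.

Definition quotmod_pi (x : M) : quotmod := \pi x.

Lemma quotmod_piP (x y : M) :
  (quotmod_pi x == quotmod_pi y) = (x - y \in N).
Proof. by rewrite /quotmod_pi piE. Qed.

Lemma quotmod_piD x y : quotmod_pi (x + y) = quotmod_pi x + quotmod_pi y.
Proof. by rewrite /quotmod_pi piE. Qed.

Definition quotmod_scale (a : A) (x : quotmod) : quotmod :=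
  quotmod_pi (a *: repr x).

Lemma quotmod_scaleE a x : quotmod_scale a (quotmod_pi x) = quotmod_pi (a *: x).
Proof.
apply/eqP; rewrite quotmod_piP -scalerBr rpredZ // -quotmod_piP.
by rewrite /quotmod_pi reprK.
Qed.

Lemma quotmodW (P : quotmod -> Prop) :
  (forall x, P (quotmod_pi x)) -> forall x, P x.
Proof. by move=> Ppi; elim/quotW. Qed.

Lemma quotmod_scaleA a b x :
  quotmod_scale a (quotmod_scale b x) = quotmod_scale (a * b) x.
Proof. by elim/quotmodW: x => x; rewrite !quotmod_scaleE scalerA. Qed.

Lemma quotmod_scale1 : left_id 1 quotmod_scale.
Proof. by elim/quotmodW=> x; rewrite quotmod_scaleE scale1r. Qed.

Lemma quotmod_scaleDr : right_distributive quotmod_scale +%R.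
Proof.
move=> a; elim/quotmodW=> x; elim/quotmodW=> y.
by rewrite -quotmod_piD !quotmod_scaleE scalerDr quotmod_piD.
Qed.

Lemma quotmod_scaleDl x : {morph quotmod_scale^~ x : a b / a + b}.
Proof.
move=> a b; elim/quotmodW: x => x.
by rewrite !quotmod_scaleE scalerDl quotmod_piD.
Qed.

HB.instance Definition _ := GRing.Zmodule_isLmodule.Build A quotmod
  quotmod_scaleA quotmod_scale1 quotmod_scaleDr quotmod_scaleDl.

End Quotient.

Section Submodules.
Variables (A : pzRingType) (M : lmodType A).

Definition span_submod (S : set M) : {pred M} := fun v =>
  `[< forall N : submodClosed M, (forall s, S s -> s \in N) -> v \in N >].

Lemma span_submod_closed S : submod_closed (span_submod S).
Proof.
split=> [|a u v /asboolP Su /asboolP Sv]; apply/asboolP => N SN.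
  exact: rpred0.
by rewrite rpredD ?rpredZ ?Su ?Sv.
Qed.

HB.instance Definition _ S := GRing.isSubmodClosed.Build A M (span_submod S)
  (GRing.submod_closed_semi (span_submod_closed S)).

Definition proper_submod (N : submodClosed M) : Prop := exists v, v \notin N.

Definition maximal_submod (N : submodClosed M) : Prop :=
  proper_submod N /\
  forall N' : submodClosed M,
    proper_submod N' -> {subset N <= N'} -> {subset N' <= N}.

(* The maximal proper submodule, for modules where it exists and is unique (for
   instance nonzero Verma modules); the zero submodule if there is none. *)
Definition rad_submod : submodClosed M :=
  if pselect (exists N, maximal_submod N) is left maxN then projT1 (cid maxN)
  else span_submod set0.

Definition simple_mod : Prop :=
  (exists v : M, v != 0) /\
  forall N : submodClosed M, (forall v, v \in N -> v = 0) \/ (forall v, v \in N).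

End Submodules.
Arguments simple_mod {A} M.
Arguments rad_submod {A} M.

Definition mod_iso (A : pzRingType) (M N : lmodType A) : Prop :=
  exists f : {linear M -> N}, bijective f.

(* Finite dimension over [K], acting on [M] through [a |-> a%:A]. *)
Definition fin_dim (K : comNzRingType) (A : algType K) (M : lmodType A) : Prop :=
  exists (n : nat) (e : 'I_n -> M),
    forall v : M, exists c : 'I_n -> K, v = \sum_(i < n) (c i)%:A *: e i.

(** * The Lie algebra [sl_m^<Q>[x]]

    The index set [{1, ..., m-1}] is ['I_m.-1], shifted by one. *)

(* In [genX b], [b = true] stands for the sign [+], [b = false] for [-]. *)
Inductive sl_gen (m : nat) : Type :=
  | genX of bool & 'I_m.-1 & nat
  | genJ of 'I_m.-1 & nat.

Definition adj_idx (m : nat) (i j : 'I_m.-1) : bool :=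
  (j == i.+1 :> nat) || (i == j.+1 :> nat).

Definition cartan (K : closedFieldType) (m : nat) (j i : 'I_m.-1) : K :=
  if j == i then 2 else if adj_idx i j then -1 else 0.

Section SlRelations.
Variables (K : closedFieldType) (m : nat) (Q : 'I_m.-1 -> K).

Local Notation term := (lie_term K (sl_gen m)).
Local Notation X b i t := (LGen (genX b i t) : term).
Local Notation J i t := (LGen (genJ i t) : term).
Local Notation "<[ x ; y ]>" := (LBr x y) (at level 0).

Inductive sl_rel : term -> term -> Prop :=
  | sl_L1 i j s t : sl_rel <[J i s; J j t]> LZero
  | sl_L2 b i j s t :
      sl_rel <[J j s; X b i t]>
             (LScale (if b then cartan K j i else - cartan K j i)
                     (X b i (s + t)%N))
  | sl_L3 i j s t :
      sl_rel <[X true i t; X false j s]>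
             (if i == j
              then LAdd (J i (s + t)%N) (LOpp (LScale (Q i) (J i (s + t).+1)))
              else LZero)
  | sl_L4 b i j s t : ~~ adj_idx i j -> sl_rel <[X b i t; X b j s]> LZero
  | sl_L5 b i j s t : adj_idx i j ->
      sl_rel <[X b i t.+1; X b j s]> <[X b i t; X b j s.+1]>
  | sl_L6 b i j s t u : adj_idx i j ->
      sl_rel <[X b i s; <[X b i t; X b j u]>]> LZero.

Definition slQ : lieAlgType K := lie_pres sl_rel.
Definition UslQ : algType K := envel slQ.

Definition UX (b : bool) (i : 'I_m.-1) (t : nat) : UslQ :=
  env_in (lie_gen sl_rel (genX b i t)).
Definition UJ (i : 'I_m.-1) (t : nat) : UslQ :=
  env_in (lie_gen sl_rel (genJ i t)).

(** ** Highest weight modules *)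

Definition highest_weight_mod (u : 'I_m.-1 -> nat -> K) (M : lmodType UslQ) :
    Prop :=
  exists v0 : M,
    [/\ v0 != 0,
        forall v : M, exists a : UslQ, v = a *: v0,
        forall i t, UX true i t *: v0 = 0
      & forall i t, UJ i t *: v0 = (u i t)%:A *: v0].

Definition verma_rel (u : 'I_m.-1 -> nat -> K) : set UslQ^o :=
  [set x | (exists i t, x = UX true i t) \/
           (exists i t, x = UJ i t - (u i t)%:A)].

(* Submodules of the regular left module [UslQ^o] are left ideals. *)
Definition verma (u : 'I_m.-1 -> nat -> K) : lmodType UslQ :=
  quotmod (span_submod (verma_rel u)).

Definition simple_hw (u : 'I_m.-1 -> nat -> K) : lmodType UslQ :=
  quotmod (rad_submod (verma u)).

End SlRelations.

(** * The classifying data *)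

Section ClassifyingData.
Variables (K : closedFieldType).

Definition in_BQ (Q : K) (beta : K) : Prop := Q = 0 -> beta = 0.

Definition in_monicQ (Q : K) (phi : {poly K}) : Prop :=
  phi \is monic /\ (Q != 0 -> ~~ root phi Q^-1).

(* The roots of [p] with multiplicity, in an unspecified order. *)
Definition poly_roots (p : {poly K}) : seq K :=
  sval (closed_field_poly_normal p).

Variables (m : nat) (Q : 'I_m.-1 -> K).

Definition param (pb : 'I_m.-1 -> {poly K} * K) : Prop :=
  forall i, in_monicQ (Q i) (pb i).1 /\ in_BQ (Q i) (pb i).2.

Definition uQ (pb : 'I_m.-1 -> {poly K} * K) (i : 'I_m.-1) (t : nat) : K :=
  if t == 0%N then (size (pb i).1).-1%:R + (pb i).2
  else \sum_(g <- poly_roots (pb i).1) g ^+ t +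
       (if Q i == 0 then 0 else (Q i) ^- t * (pb i).2).

End ClassifyingData.

(* Main.v *)
From HB Require Import structures.
Require Import Defs.
From mathcomp Require Import all_boot all_order all_algebra perm.
From mathcomp Require Import boolp classical_sets reals.
From mathcomp Require Import ring zify mxtens.

Set Implicit Arguments.
Unset Strict Implicit.
Unset Printing Implicit Defensive.

Import GRing.Theory Num.Theory.
Local Open Scope ring_scope.

(** The Lie algebra maps to sl_m[x] by X^+_{i,t} |-> e_i x^t,
    J_{i,t} |-> h_i x^t and X^-_{i,t} |-> f_i x^t (1 - Q_i x), so evaluating [x]
    at a point turns modules over sl_m into modules over it.  There are also
    one-dimensional modules on which every X^+_{i,t} and every X^-_{i,t}
    is 0 and J_{i,t} is [Q_i^-t * beta_i]: then J_{i,t} - Q_i J_{i,t+1} acts by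
    0, provided that [beta_i = 0] in case [Q_i = 0].

    Existence.  The weight of a tensor product of highest weight vectors is the
    sum of the weights, so the evaluations at the roots of the [phi_i] of the
    fundamental modules of sl_m, together with a one-dimensional twist, give a
    finite dimensional module with a highest weight vector of weight
    [uQ Q pb] ([realizable_uQ]).  The annihilator of that vector is a proper
    left ideal containing the relations of the Verma module, hence it kills the
    generator of the simple quotient, which is therefore finite dimensional
    ([realizable_fin_dim]).  The same vector shows that the Verma module is
    nonzero.

    Maximal submodules.  The element [Urho] of the Cartan part has eigenvalue
    [lam - k] on the vectors obtained by applying [k] lowering operators to a
    highest weight vector of eigenvalue [lam].  A submodule with an element
    whose component of eigenvalue [lam] is nonzero contains the generator, so
    the sum of all proper submodules is proper ([hw_rad_maximal]).  Comparing
    eigenvalues also shows that a module has only one highest weight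
    ([hw_unique]).

    Classification.  In a finite dimensional simple module, raising operators
    cannot be applied to an eigenvector of [Urho] indefinitely, which yields a
    highest weight vector [v] ([exists_hw_vector]).  To find its weight [u], fix
    [i] and regard [u i] as a linear functional [w] on polynomials, [w x^t]
    being [u i t].  Let [p] be the polynomial of least degree such that all
    X^-_i(p g) annihilate [v]; by simplicity this means that [w] vanishes on the
    multiples of [(1 - Q x) p].  For suitable polynomials [a] and [b], the
    operators X^+_i(a) and X^-_i(b) act on [v] and its descendants like a
    standard triple of sl_2, or of the Heisenberg algebra ([rank_one]).  The
    second case contradicts minimality as soon as [p] has a double root or a
    common root with [1 - Q x]; the first one, applied at each root of [p],
    shows that [w] is on the multiples of [1 - Q x] a combination of evaluations
    at the roots of [p] with natural number coefficients ([weight_current]).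
    These coefficients are the multiplicities of the roots of [phi], and [beta]
    is the coefficient of the evaluation at [1 / Q], which multiples of
    [1 - Q x] do not see ([weight_param]).

    Uniqueness follows because evaluations at distinct points are linearly
    independent functionals ([param_inj]). *)

(** * Submodules and quotient modules *)

Section Submodules.
Variables (A : pzRingType) (M : lmodType A).

Definition submod_of (P : {pred M}) (closedP : submod_closed P) :
    submodClosed M :=
  HB.pack P (GRing.isSubmodClosed.Build A M P
    (GRing.submod_closed_semi closedP)).

Lemma mem_submod_of (P : {pred M}) (closedP : submod_closed P) v :
  (v \in submod_of closedP) = P v.
Proof. by []. Qed.

Lemma mem_span_submod (S : set M) v : S v -> v \in span_submod S.
Proof. by move=> Sv; apply/asboolP => N; apply. Qed.

Lemma span_submod_sub (S : set M) (N : submodClosed M) v :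
  (forall s, S s -> s \in N) -> v \in span_submod S -> v \in N.
Proof. by move=> SN /asboolP; apply. Qed.

Lemma quotmod_eq0 (N : submodClosed M) (x : M) :
  quotmod_pi N x = 0 <-> x \in N.
Proof.
have pi0 : quotmod_pi N 0 = 0.
  have := quotmod_piD N 0 0; rewrite addr0 => /eqP.
  by rewrite -{1}[quotmod_pi N 0]addr0 => /eqP /addrI.
rewrite -pi0; split=> [/eqP|xN]; first by rewrite quotmod_piP subr0.
by apply/eqP; rewrite quotmod_piP subr0.
Qed.

Lemma quotmod_piZ (N : submodClosed M) a (x : M) :
  quotmod_pi N (a *: x) = a *: quotmod_pi N x.
Proof. by rewrite -quotmod_scaleE. Qed.

Lemma quotmod_simple (N : submodClosed M) :
  maximal_submod N -> simple_mod (quotmod N).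
Proof.
move=> [[v vN] maxN]; split.
  by exists (quotmod_pi N v); apply/eqP => /quotmod_eq0; apply/negP.
move=> P.
have cl : submod_closed (fun x : M => quotmod_pi N x \in P).
  split=> [|a x y xP yP].
    rewrite unfold_in (_ : quotmod_pi N 0 = 0) ?rpred0 //.
    exact/quotmod_eq0/rpred0.
  by rewrite unfold_in quotmod_piD quotmod_piZ rpredD // rpredZ.
have [[w wP]|allP] := pselect (exists w, quotmod_pi N w \notin P).
  left; elim/quotmodW=> x xP; apply/quotmod_eq0.
  apply: (maxN (submod_of cl)) => //; first by exists w.
  move=> y /quotmod_eq0 y0; rewrite mem_submod_of y0; exact: rpred0.
right; elim/quotmodW => x; apply/negP => xP.
by apply: allP; exists x; apply/negP.
Qed.

End Submodules.

(** Both modules are the quotient of [A] by the common annihilator, and the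
    isomorphism takes [a *: v] to [a *: w]. *)
Lemma cyclic_mod_iso (A : pzRingType) (M N : lmodType A) (v : M) (w : N) :
  (forall x : M, exists a : A, x = a *: v) ->
  (forall y : N, exists a : A, y = a *: w) ->
  (forall a : A, a *: v = 0 <-> a *: w = 0) ->
  mod_iso M N.
Proof.
move=> genv genw ann.
have annB a b : a *: v = b *: v <-> a *: w = b *: w.
  split=> /eqP; rewrite -subr_eq0 -scalerBl => /eqP /ann /eqP;
  by rewrite scalerBl subr_eq0 => /eqP.
pose f x := projT1 (cid (genv x)) *: w.
have fE a : f (a *: v) = a *: w.
  by rewrite /f; case: cid => b /= /annB.
have linf : linear f.
  move=> c x y; have [a ->] := genv x; have [b ->] := genv y.
  by rewrite scalerA -scalerDl !fE scalerDl scalerA.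
pose F : {linear M -> N} := HB.pack f (GRing.isLinear.Build A M N _ f linf).
exists F; exists (fun y => projT1 (cid (genw y)) *: v).
  move=> x /=; have [a ->] := genv x; rewrite fE.
  by case: cid => b /= /annB.
by move=> y /=; rewrite fE; case: cid.
Qed.

(** * Linear algebra in a module over an algebra *)

Section ScalarAction.
Variables (K : comNzRingType) (A : algType K) (M : lmodType A).
Implicit Types (a b : K) (h : A) (v : M).

Lemma scalkA a b v : a%:A *: (b%:A *: v) = (a * b)%:A *: v.
Proof. by rewrite scalerA -scalerAl mul1r scalerA. Qed.

Lemma scalkDl a b v : (a + b)%:A *: v = a%:A *: v + b%:A *: v.
Proof. by rewrite !scalerDl. Qed.

Lemma scalkBl a b v : (a - b)%:A *: v = a%:A *: v - b%:A *: v.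
Proof. by rewrite !scalerBl. Qed.

Lemma scalkNl a v : (- a)%:A *: v = - (a%:A *: v).
Proof. by rewrite !scaleNr. Qed.

Lemma scalk0 v : (0 : K)%:A *: v = 0.
Proof. by rewrite !scale0r. Qed.

Lemma scalk1 v : (1 : K)%:A *: v = v.
Proof. by rewrite !scale1r. Qed.

Lemma scalkC a h v : h *: (a%:A *: v) = a%:A *: (h *: v).
Proof. by rewrite !scalerA -scalerAl -scalerAr mul1r mulr1. Qed.

Lemma scalkAl a h v : (a *: h) *: v = a%:A *: (h *: v).
Proof. by rewrite scalerA -scalerAl mul1r. Qed.

End ScalarAction.

Lemma scalk_eq0 (K : fieldType) (A : algType K) (M : lmodType A) (a : K)
  (v : M) : a%:A *: v = 0 -> v != 0 -> a = 0.
Proof.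
move=> av /eqP v0; apply/eqP; apply: contrapT => /negP a0; apply: v0.
by rewrite -[v](scalk1 (A := A)) -(mulVf a0) -scalkA av scaler0.
Qed.

Lemma wide_kernel (K : fieldType) n (C : 'M[K]_(n.+1, n)) :
  exists2 c : 'I_n.+1 -> K, exists i, c i != 0
                          & forall k, \sum_j c j * C j k = 0.
Proof.
have kerC : kermx C != 0.
  by rewrite -mxrank_eq0 mxrank_ker subn_eq0 -ltnNge ltnS rank_leq_col.
have /existsP [i kerCi] : [exists i, row i (kermx C) != 0].
  rewrite -negb_forall; apply: contra kerC => /forallP H.
  by apply/eqP/row_matrixP => i; rewrite row0; apply/eqP.
exists (fun j => kermx C i j).
  by have /rV0Pn [j] := kerCi; rewrite mxE; exists j.
move=> k; have := congr1 (fun B : 'M_(_, _) => B i k) (mulmx_ker C).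
by rewrite mxE [in RHS]mxE.
Qed.

Section FiniteDimension.
Variables (K : closedFieldType) (A : algType K) (M : lmodType A).

(** The [K]-span of [S] has dimension at most [n]. Dependence is the convenient
    form because [K] acts on [M] only through [A], and because it passes to
    subsets. *)
Definition dim_le (S : M -> Prop) (n : nat) : Prop :=
  forall w : 'I_n.+1 -> M, (forall i, S (w i)) ->
    exists2 c : 'I_n.+1 -> K, exists i, c i != 0
                            & \sum_i (c i)%:A *: w i = 0.

(** If no family of [n.+1] vectors is independent then the bound can be lowered;
    otherwise an independent family of [n.+1] vectors is a basis. *)
Lemma dim_le_fin n : dim_le (fun=> True) n -> fin_dim M.
Proof.
elim: n => [|n IHn] dep.
  exists 0%N, (fun=> 0) => v; exists (fun=> 0); rewrite big_ord0.
  have [c [i ci]] := dep (fun=> v) (fun=> I).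
  rewrite big_ord1 => cv; apply/eqP; apply: contraT => v0.
  by rewrite (ord1 i) (scalk_eq0 cv v0) eqxx in ci.
have [/IHn //|ndep] := pselect (dim_le (fun=> True) n).
have [e indep_e] : exists e : 'I_n.+1 -> M, forall c : 'I_n.+1 -> K,
    \sum_i (c i)%:A *: e i = 0 -> forall i, c i = 0.
  apply: contrapT => noe; apply: ndep => w _; apply: contrapT => noc.
  apply: noe; exists w => c c0 i; apply/eqP; apply: contrapT => /negP ci.
  by apply: noc; exists c => //; exists i.
exists n.+1, e => v.
pose w (i : 'I_n.+2) := if unlift ord0 i is Some j then e j else v.
have [c [i ci]] := dep w (fun=> I).
rewrite big_ord_recl {1}/w unlift_none.
under eq_bigr do rewrite /w liftK.
have [c0|c0] := eqVneq (c ord0) 0.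
  rewrite c0 scalk0 add0r => /indep_e cl.
  move: ci; case: (unliftP ord0 i) => [j ->|->]; last by rewrite c0 eqxx.
  by rewrite cl eqxx.
move=> /eqP; rewrite addr_eq0 => /eqP vE.
exists (fun j => - ((c ord0)^-1 * c (lift ord0 j))).
move/(congr1 (fun x => (c ord0)^-1%:A *: x)): vE.
rewrite scalkA mulVf // scalk1 => ->.
rewrite scalerN scaler_sumr -sumrN; apply: eq_bigr => j _.
by rewrite scalkA scalkNl.
Qed.

Lemma fin_dim_le : fin_dim M -> exists n, dim_le (fun=> True) n.
Proof.
move=> [n [e span_e]]; exists n => w _.
have /choice [c wE] := fun i => span_e (w i).
have [d d0 dC] := wide_kernel (\matrix_(i < n.+1, j < n) c i j).
exists d => //; under eq_bigr do rewrite wE scaler_sumr.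
rewrite exchange_big /= big1 // => k _.
under eq_bigr do rewrite scalkA.
rewrite -scaler_suml -scaler_suml; have := dC k.
by under eq_bigr do rewrite mxE; move=> ->; rewrite scalk0.
Qed.

Lemma horner_alg_eigen (h : A) (mu : K) (v : M) (p : {poly K}) :
  h *: v = mu%:A *: v -> horner_alg h p *: v = p.[mu]%:A *: v.
Proof.
move=> hv; elim/poly_ind: p => [|p c IHp].
  by rewrite rmorph0 horner0 scalk0 scale0r.
rewrite rmorphD rmorphM /= horner_algX horner_algC hornerMXaddC.
by rewrite scalkDl scalerDl -scalerA hv scalkC IHp scalkA mulrC.
Qed.

(** A polynomial in [h] vanishing at all but one of the eigenvalues isolates one
    coefficient of a linear dependence between the eigenvectors. *)
Lemma fin_dim_eigen0 (h : A) (mu : nat -> K) (w : nat -> M) :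
  fin_dim M -> injective mu -> (forall k, h *: w k = (mu k)%:A *: w k) ->
  exists k, w k = 0.
Proof.
move=> /fin_dim_le [n dep] inj_mu hw.
apply: contrapT => /forallNP w0.
have [c [i ci] cw] := dep (fun i => w i) (fun=> I).
pose p := \prod_(j < n.+1 | j != i) ('X - (mu j)%:P).
have := congr1 (fun x => horner_alg h p *: x) cw.
rewrite scaler0 scaler_sumr (bigD1 i) //= big1 => [|j ji]; last first.
  rewrite scalkC (horner_alg_eigen _ (hw j)) (_ : p.[_] = 0) ?scalk0 ?scaler0 //.
  by rewrite horner_prod (bigD1 j) //= !hornerE subrr mul0r.
rewrite addr0 scalkC (horner_alg_eigen _ (hw i)) scalkA => /scalk_eq0.
move=> /(_ (introN eqP (w0 i))) /eqP; rewrite mulf_eq0 (negPf ci) /=.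
rewrite horner_prod prodf_seq_eq0 => /hasP [j _ /andP [ji]].
rewrite !hornerE subr_eq0 => /eqP /inj_mu /val_inj ij.
by rewrite ij eqxx in ji.
Qed.

(** A dependence between the iterates of [h] on [v] is a polynomial in [h]
    killing [v]; one of its linear factors has a kernel on [S]. *)
Lemma exists_eigenvector (h : A) (S : M -> Prop) n v :
  dim_le S n -> (forall x, S x -> S (h *: x)) ->
  (forall a x, S x -> S (a%:A *: x)) -> (forall x y, S x -> S y -> S (x + y)) ->
  S v -> v != 0 ->
  exists mu x, [/\ S x, x != 0 & h *: x = mu%:A *: x].
Proof.
move=> dep Sh SZ SD Sv v0.
have S0 : S 0 by rewrite -(scalk0 (A := A) v); apply: SZ.
have SX p x : S x -> S (horner_alg h p *: x).
  elim/poly_ind: p x => [|p c IHp] x Sx; first by rewrite rmorph0 scale0r.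
  rewrite rmorphD rmorphM /= horner_algX horner_algC scalerDl -scalerA.
  by apply: SD; [apply/IHp/Sh|apply: SZ].
have Shv i : S (h ^+ i *: v).
  by have := SX 'X^i v Sv; rewrite rmorphXn /= horner_algX.
have [c [i ci] cv] := dep (fun i => h ^+ i *: v) (fun i => Shv i).
pose p := \poly_(j < n.+1) c (inord j).
have pv : horner_alg h p *: v = 0.
  rewrite -cv /p poly_def linear_sum scaler_suml; apply: eq_bigr => j _.
  by rewrite linearZ rmorphXn /= horner_algX inord_val -scalerA.
have p0 : p != 0.
  apply/eqP => /(congr1 (fun q : {poly K} => q`_i)).
  by rewrite coef0 coef_poly ltn_ord inord_val => /eqP; apply/negP.
have [rs pE] := closed_field_poly_normal p.
have : horner_alg h (\prod_(z <- rs) ('X - z%:P)) *: v = 0.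
  apply/eqP; apply: contraT => pv0; move: pv; rewrite pE linearZ /= -scalerA.
  by move=> /scalk_eq0 /(_ pv0) /eqP; rewrite lead_coef_eq0 (negPf p0).
elim: rs {pE} => [|z rs IHrs].
  by rewrite big_nil rmorph1 scale1r => /eqP; rewrite (negPf v0).
rewrite big_cons rmorphM -scalerA rmorphB /= horner_algX horner_algC.
have [/IHrs //|x0] := eqVneq (horner_alg h (\prod_(z <- rs) ('X - z%:P)) *: v) 0.
rewrite scalerBl => /eqP; rewrite subr_eq0 => /eqP hx.
by exists z; eexists; split; [apply: SX Sv|apply: x0|apply: hx].
Qed.

(** A commuting family, possibly infinite, has a common eigenvector: as long
    as some member is not a scalar on [S], one of its eigenspaces is a smaller
    stable subspace. *)
Lemma commuting_eigenvector (I : Type) (h : I -> A) (S : M -> Prop) n v :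
  (forall i j x, S x -> h i *: (h j *: x) = h j *: (h i *: x)) ->
  dim_le S n -> (forall i x, S x -> S (h i *: x)) ->
  (forall a x, S x -> S (a%:A *: x)) -> (forall x y, S x -> S y -> S (x + y)) ->
  S v -> v != 0 ->
  exists2 x, S x /\ x != 0 & forall i, exists mu, h i *: x = mu%:A *: x.
Proof.
elim: n S v => [|n IHn] S v hC dep Sh SZ SD Sv v0.
  have [c [i ci]] := dep (fun=> v) (fun=> Sv).
  rewrite big_ord1 => /scalk_eq0 /(_ v0) /eqP.
  by rewrite (ord1 i) in ci; rewrite (negPf ci).
have [scal|] := pselect (forall i, exists mu, forall x, S x -> h i *: x = mu%:A *: x).
  by exists v => // i; have [mu hi] := scal i; exists mu; apply: hi.
move=> /existsNP [i /forallNP nscal].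
have [mu [x [Sx x0 hx]]] := exists_eigenvector dep (Sh i) SZ SD Sv v0.
have [y Sy hy] : exists2 y, S y & h i *: y <> mu%:A *: y.
  by have /existsNP [y /not_implyP [Sy hy]] := nscal mu; exists y.
pose S' z := S z /\ h i *: z = mu%:A *: z.
(* [y] is outside [S'], so adding it to [n.+1] vectors of [S'] shows that the
   dimension drops. *)
have [|||||||z [[Sz _] z0] hz] := IHn S' x; last by exists z.
- by move=> j k z [Sz _]; apply: hC.
- move=> w Sw.
  pose w' (k : 'I_n.+2) := if unlift ord0 k is Some j then w j else y.
  have [|c [k ck]] := dep w'.
    by move=> k; rewrite /w'; case: unliftP => [j|] _ //; have [] := Sw j.
  rewrite big_ord_recl {1}/w' unlift_none; under eq_bigr do rewrite /w' liftK.
  have [c0 cw|c0 cw] := eqVneq (c ord0) 0.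
    exists (fun j => c (lift ord0 j)); last by rewrite -[RHS]cw c0 scalk0 add0r.
    move: ck; case: (unliftP ord0 k) => [j ->|->]; last by rewrite c0 eqxx.
    by exists j.
  case: hy; have := congr1 (fun z => (h i - mu%:A) *: z) cw.
  rewrite scaler0 scalerDr scalkC scaler_sumr big1 => [|j _]; last first.
    by rewrite scalkC scalerBl; have [_ ->] := Sw j; rewrite subrr scaler0.
  rewrite addr0 => {}cw; apply/eqP; rewrite -subr_eq0 -scalerBl.
  by apply: contraT => /(scalk_eq0 cw) /eqP; rewrite (negPf c0).
- by move=> j z [Sz hz]; split; [apply: Sh|rewrite hC // hz scalkC].
- by move=> a z [Sz hz]; split; [apply: SZ|rewrite scalkC hz !scalkA mulrC].
- by move=> z t [Sz hz] [St ht]; split; [apply: SD|rewrite !scalerDr hz ht].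
- by [].
- by [].
Qed.

End FiniteDimension.

(** * Generators and relations of the enveloping algebra *)

Section EnvelopingAlgebra.
Variables (K : comNzRingType) (L : lieAlgType K).

Lemma env_in_linear a (x y : L) : env_in (a *: x + y) = a *: env_in x + env_in y.
Proof.
rewrite /env_in (_ : _ + _ = \pi_(envel L)%qT (EAdd (EScale a (EIn x)) (EIn y))).
  by apply/env_piP/env_eq_in.
by rewrite -ev_addE -ev_scaleE.
Qed.

Lemma env_in0 : env_in (0 : L) = 0.
Proof.
by have := env_in_linear (-1) (0 : L) 0; rewrite scaler0 addr0 scaleN1r addNr.
Qed.

Lemma env_inD (x y : L) : env_in (x + y) = env_in x + env_in y.
Proof. by rewrite -[x in LHS]scale1r env_in_linear scale1r. Qed.

Lemma env_inZ a (x : L) : env_in (a *: x) = a *: env_in x.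
Proof. by rewrite -[a *: x]addr0 env_in_linear env_in0 addr0. Qed.

Lemma env_inN (x : L) : env_in (- x) = - env_in x.
Proof. by rewrite -scaleN1r env_inZ scaleN1r. Qed.

Lemma env_in_br (x y : L) :
  env_in (lie_br x y) = env_in x * env_in y - env_in y * env_in x.
Proof.
rewrite /env_in; have /env_piP -> := env_eq_br x y.
by rewrite -ev_addE -ev_oppE -!ev_mulE.
Qed.

Lemma env_ind (P : envel L -> Prop) :
  P 1 -> (forall a b, P a -> P b -> P (a + b)) ->
  (forall c a, P a -> P (c *: a)) -> (forall a b, P a -> P b -> P (a * b)) ->
  (forall x, P (env_in x)) -> forall a, P a.
Proof.
move=> P1 PD PZ PM Pin; have P0 : P 0 by rewrite -(scale0r 1); apply: PZ.
have PN a : P a -> P (- a) by rewrite -scaleN1r; apply: PZ.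
elim/env_piW; elim=> [x|||x Px y Py|x Px|a x Px|x Px y Py] //.
- exact: Pin.
- by rewrite -[X in P X]ev_addE; apply: PD.
- by rewrite -[X in P X]ev_oppE; apply: PN.
- by rewrite -[X in P X]ev_scaleE; apply: PZ.
- by rewrite -[X in P X]ev_mulE; apply: PM.
Qed.

End EnvelopingAlgebra.

Section Generators.
Variables (K : closedFieldType) (m : nat) (Q : 'I_m.-1 -> K).
Local Notation U := (UslQ Q).

Lemma U_ind (P : U -> Prop) :
  P 1 -> (forall a b, P a -> P b -> P (a + b)) ->
  (forall c a, P a -> P (c *: a)) -> (forall a b, P a -> P b -> P (a * b)) ->
  (forall b i t, P (UX Q b i t)) -> (forall i t, P (UJ Q i t)) ->
  forall a, P a.
Proof.
move=> P1 PD PZ PM PX PJ.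
have P0 : P 0 by rewrite -(scale0r 1); apply: PZ.
have PN a : P a -> P (- a) by rewrite -[- a]scaleN1r; apply: PZ.
apply: env_ind => //; elim/lie_piW.
elim=> [[b i t|i t]||x Px y Py|x Px|a x Px|x Px y Py].
- exact: PX.
- exact: PJ.
- by rewrite (_ : env_in _ = 0) // -[RHS](env_in0 (slQ Q)).
- by rewrite lie_piD env_inD; apply: PD.
- by rewrite -lp_oppE env_inN; apply: PN.
- by rewrite lie_piZ env_inZ; apply: PZ.
- by rewrite -lp_brE env_in_br; apply/PD/PN/PM => //; apply: PM.
Qed.

Lemma sl_rel_env x y : sl_rel Q x y ->
  env_in (\pi_(slQ Q)%qT x : slQ Q) = env_in (\pi_(slQ Q)%qT y : slQ Q).
Proof. by move=> /lie_eq_rel /lie_piP ->. Qed.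

Lemma UJJ i j s t : UJ Q i s * UJ Q j t = UJ Q j t * UJ Q i s.
Proof.
apply/eqP; rewrite -subr_eq0 /UJ -env_in_br; apply/eqP.
have := sl_rel_env (sl_L1 Q i j s t).
by rewrite -lp_brE => ->; rewrite -[RHS](env_in0 (slQ Q)).
Qed.

Lemma UJX b i j s t : UJ Q j s * UX Q b i t =
  UX Q b i t * UJ Q j s +
  (if b then cartan K j i else - cartan K j i) *: UX Q b i (s + t).
Proof.
apply/eqP; rewrite addrC -subr_eq /UX /UJ -env_in_br; apply/eqP.
have := sl_rel_env (sl_L2 Q b i j s t).
by rewrite -lp_brE lie_piZ env_inZ.
Qed.

Lemma UXX i j s t : UX Q true i t * UX Q false j s =
  UX Q false j s * UX Q true i t +
  (if i == j then UJ Q i (s + t) - Q i *: UJ Q i (s + t).+1 else 0).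
Proof.
apply/eqP; rewrite addrC -subr_eq /UX /UJ -env_in_br; apply/eqP.
have := sl_rel_env (sl_L3 Q i j s t); rewrite -lp_brE => ->.
case: eqP => _; last by rewrite -[RHS](env_in0 (slQ Q)).
by rewrite lie_piD env_inD -lp_oppE env_inN lie_piZ env_inZ.
Qed.

Lemma UXC b i s t : UX Q b i t * UX Q b i s = UX Q b i s * UX Q b i t.
Proof.
apply/eqP; rewrite -subr_eq0 /UX -env_in_br; apply/eqP.
have nadj : ~~ adj_idx i i by rewrite /adj_idx orbb neq_ltn ltnSn.
have := sl_rel_env (sl_L4 Q b s t nadj).
by rewrite -lp_brE => ->; rewrite -[RHS](env_in0 (slQ Q)).
Qed.
End Generators.

Section Grading.
Variables (K : numClosedFieldType) (m : nat) (Q : 'I_m.-1 -> K).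
Local Notation U := (UslQ Q).

(** The coefficients of the half sum of the positive coroots in terms of the
    simple ones. *)
Definition rho_coef (j : nat) : K := (j.+1 * (m.-1 - j))%:R / 2.

(** Twice the coefficient is the quadratic function [(j + 1) (r - j)], with
    [r = m.-1], which vanishes at [j = -1] and [j = r], and whose second
    difference is -2: this absorbs the two ends of the Dynkin diagram. *)
Lemma sum_rho_cartan (i : 'I_m.-1) :
  \sum_(j < m.-1) rho_coef j * cartan K j i = 1.
Proof.
have cE (j : 'I_m.-1) : rho_coef j * cartan K j i =
    2 * (rho_coef j * (j == i)%:R) - (rho_coef j * (j == i.+1 :> nat)%:R)
    - (rho_coef j * (i == j.+1 :> nat)%:R).
  rewrite /cartan /adj_idx; case: (eqVneq j i) => [->|ji] /=.
    by rewrite !(ltn_eqF (ltnSn _), gtn_eqF (ltnSn _)) !mulr0 mulr1 !subr0 mulrC.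
  case: (eqVneq (j : nat) i.+1) => [->|ji1] /=.
    by rewrite ltn_eqF ?mulr0 ?mulr1 ?sub0r ?subr0 ?mulrN1 // ltnS ltnW.
  by case: (_ == _); rewrite !mulr0 ?mulr1 ?subr0 ?sub0r ?mulrN1.
under eq_bigr do rewrite cE.
rewrite !sumrB -mulr_sumr.
have pick (k : nat) (P : 'I_m.-1 -> bool) (kP : forall j, P j = (j == k :> nat)) :
    \sum_(j < m.-1) rho_coef j * (P j)%:R = if (k < m.-1)%N then rho_coef k else 0.
  case: ifP => [km|km].
    rewrite (bigD1 (Ordinal km)) //= kP eqxx mulr1 big1 ?addr0 // => j.
    by rewrite -val_eqE kP /= => /negPf ->; rewrite mulr0.
  rewrite big1 // => j _; rewrite kP; case: eqP => [jk|]; last by rewrite mulr0.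
  by rewrite -jk ltn_ord in km.
rewrite (pick i) // (pick i.+1) // ltn_ord.
have -> : \sum_(j < m.-1) rho_coef j * (i == j.+1 :> nat)%:R =
          if (0 < i)%N then rho_coef i.-1 else 0.
  case: ifP => [i0|i0].
    rewrite (pick i.-1) ?(leq_ltn_trans (leq_pred i)) // => j.
    by rewrite -{1}(prednK i0) eqSS eq_sym.
  by rewrite big1 // => j _; case: eqP => [ij|_]; [rewrite ij in i0|rewrite mulr0].
have -> : (if (i.+1 < m.-1)%N then rho_coef i.+1 else 0) = rho_coef i.+1.
  case: ifP => // /negbT; rewrite -leqNgt -subn_eq0 /rho_coef => /eqP ->.
  by rewrite muln0 mul0r.
have [d rE] : exists d, m.-1 = (i + d.+1)%N.
  by exists (m.-1 - i.+1)%N; rewrite addnS -addSn subnKC.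
have -> : (if (0 < i)%N then rho_coef i.-1 else 0) = (i * d.+2)%:R / 2.
  case: ifP => [i0|/negbT]; last by rewrite lt0n negbK => /eqP ->; rewrite mul0r.
  by rewrite /rho_coef prednK // (_ : (m.-1 - i.-1)%N = d.+2) //; lia.
have [ri ri1] : (m.-1 - i)%N = d.+1 /\ (m.-1 - i.+1)%N = d by lia.
rewrite /rho_coef ri ri1 !natrM -![_.+1%:R]natr1.
by field.
Qed.

Definition Urho : U := \sum_(j < m.-1) rho_coef j *: UJ Q j 0.

Lemma UrhoX b i t : Urho * UX Q b i t =
  UX Q b i t * Urho + (if b then 1 else -1) *: UX Q b i t.
Proof.
rewrite /Urho mulr_suml mulr_sumr.
under eq_bigr do rewrite -scalerAl UJX add0n scalerDr scalerAr scalerA.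
rewrite big_split /= -scaler_suml; congr (_ + _ *: _).
case: b; first exact: sum_rho_cartan.
by under eq_bigr do rewrite mulrN; rewrite sumrN sum_rho_cartan.
Qed.

End Grading.

(** * Highest weight modules *)

Section SingularSpaces.
Variables (K : numClosedFieldType) (m : nat) (Q : 'I_m.-1 -> K).
Variable M : lmodType (UslQ Q).
Local Notation U := (UslQ Q).
Local Notation H := (Urho Q).

(** A set of vectors of top degree from which a submodule can be generated by
    lowering operators alone. The multiples of a highest weight vector form such
    a set; in [weight_kills] there is one on which the [UJ] do not act by
    scalars. *)
Definition singular (Y : M -> Prop) (mu : K) : Prop :=
  [/\ forall y, Y y -> forall i t, UX Q true i t *: y = 0,
      forall y, Y y -> forall i t, Y (UJ Q i t *: y)
    & forall y, Y y -> H *: y = mu%:A *: y].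

(** [lowered Y k] holds for the results of applying [k] lowering operators to
    [Y], and [lower_span] is the [K]-span of these for all [k]. *)
Inductive lowered (Y : M -> Prop) : nat -> M -> Prop :=
  | lowered0 y : Y y -> lowered Y 0 y
  | loweredS k i t y :
      lowered Y k y -> lowered Y k.+1 (UX Q false i t *: y).

Inductive lower_span (Y : M -> Prop) : M -> Prop :=
  | lower_span0 : lower_span Y 0
  | lower_spanD (c : K) k x y :
      lower_span Y x -> lowered Y k y -> lower_span Y (x + c%:A *: y).

Section Span.
Variables (Y : M -> Prop) (mu : K).
Hypothesis singY : singular Y mu.

Lemma lowered_eigen k v :
  lowered Y k v -> H *: v = (mu - k%:R)%:A *: v.
Proof.
have [_ _ HY] := singY.
elim=> {k v} [y Yy|k i t y _ IHy]; first by rewrite subr0 HY.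
rewrite scalerA UrhoX scalerDl -scalerA IHy scalkC -natr1.
by rewrite [X in _ + X]scalkAl -scalkDl opprD addrA.
Qed.

Lemma lower_span_lowered k y : lowered Y k y -> lower_span Y y.
Proof.
by move=> Yy; rewrite -[y]add0r -[y](scalk1 (A := U));
  apply: lower_spanD Yy; constructor.
Qed.

Lemma lower_span_add x y :
  lower_span Y x -> lower_span Y y -> lower_span Y (x + y).
Proof.
move=> Yx; elim=> [|c k y' z _ IHy Yz]; first by rewrite addr0.
by rewrite addrA; apply: lower_spanD IHy Yz.
Qed.

Lemma lower_span_scale (c : K) x : lower_span Y x -> lower_span Y (c%:A *: x).
Proof.
elim=> [|b k y z _ IHy Yz]; first by rewrite scaler0; constructor.
by rewrite scalerDr scalkA; apply: lower_spanD IHy Yz.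
Qed.

Lemma lower_spanN i t x : lower_span Y x -> lower_span Y (UX Q false i t *: x).
Proof.
elim=> [|b k y z _ IHy Yz]; first by rewrite scaler0; constructor.
by rewrite scalerDr scalkC; apply: lower_spanD IHy (loweredS _ _ Yz).
Qed.

Lemma lower_spanJ i t x : lower_span Y x -> lower_span Y (UJ Q i t *: x).
Proof.
have [_ JY _] := singY.
suff JL k y : lowered Y k y -> forall i t, lower_span Y (UJ Q i t *: y).
  elim=> [|b k y z _ IHy Yz]; first by rewrite scaler0; constructor.
  rewrite scalerDr scalkC; apply: lower_span_add IHy _.
  exact/lower_span_scale/(JL k).
elim=> {k y i t x} [y Yy|k j s y Yy IHy] i t.
  by apply: (@lower_span_lowered 0); constructor; apply: JY.
rewrite scalerA UJX scalerDl -scalerA scalkAl.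
apply: lower_span_add; first exact/lower_spanN.
by apply/lower_span_scale/(@lower_span_lowered k.+1); constructor.
Qed.

(** A raising operator is moved to the right through the lowering ones, leaving
    Cartan elements behind, until it meets [Y]. *)
Lemma lower_spanP i t x : lower_span Y x -> lower_span Y (UX Q true i t *: x).
Proof.
have [XY _ _] := singY.
suff XL k y : lowered Y k y -> forall i t, lower_span Y (UX Q true i t *: y).
  elim=> [|b k y z _ IHy Yz]; first by rewrite scaler0; constructor.
  rewrite scalerDr scalkC; apply: lower_span_add IHy _.
  exact/lower_span_scale/(XL k).
elim=> {k y i t x} [y Yy|k j s y Yy IHy] i t; first by rewrite XY //; constructor.
rewrite scalerA UXX scalerDl -scalerA.
apply: lower_span_add; first exact/lower_spanN.
case: eqP => _; last by rewrite scale0r; constructor.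
rewrite scalerBl scalkAl -scalkNl; apply: lower_span_add.
  exact/lower_spanJ/lower_span_lowered/Yy.
exact/lower_span_scale/lower_spanJ/lower_span_lowered/Yy.
Qed.

Lemma lower_spanU a x : lower_span Y x -> lower_span Y (a *: x).
Proof.
move: a x; apply: U_ind => [x|a b Pa Pb x Yx|c a Pa x Yx|a b Pa Pb x Yx|b i t x|i t x].
- by rewrite scale1r.
- by rewrite scalerDl; apply: lower_span_add; [apply: Pa|apply: Pb].
- by rewrite scalkAl; apply/lower_span_scale/Pa.
- by rewrite -scalerA; apply/Pa/Pb.
- by case: b; [apply: lower_spanP|apply: lower_spanN].
- exact: lower_spanJ.
Qed.

Lemma lower_span_annih x : lower_span Y x -> exists n : nat,
  horner_alg H (\prod_(0 <= k < n) ('X - (mu - k%:R)%:P)) *: x = 0.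
Proof.
pose ann n := horner_alg H (\prod_(0 <= k < n) ('X - (mu - k%:R)%:P)).
have annW n n' (v : M) : (n <= n')%N -> ann n *: v = 0 -> ann n' *: v = 0.
  move=> nn' annv; rewrite /ann (@big_cat_nat _ _ _ n) //= mulrC rmorphM.
  by rewrite -scalerA annv scaler0.
elim=> [|c k y z _ [n IHy] Yz]; first by exists 0%N; rewrite scaler0.
exists (maxn n k.+1); rewrite scalerDr (annW n) ?leq_maxl // add0r scalkC.
rewrite (annW k.+1) ?scaler0 ?leq_maxr //.
rewrite /ann (horner_alg_eigen _ (lowered_eigen Yz)) big_nat_recr //=.
by rewrite hornerM !hornerE subrr mulr0 scalk0.
Qed.

(** On the submodule generated by [Y], a product of factors
    [H - (mu - k)] annihilates any given vector. *)
Lemma singular_eigenvalue y a (nu : K) : Y y -> a *: y != 0 ->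
  H *: (a *: y) = nu%:A *: (a *: y) -> exists k : nat, nu = mu - k%:R.
Proof.
move=> Yy ay0 Hay.
have /lower_span_annih [n] := lower_spanU a (lower_span_lowered (lowered0 Yy)).
rewrite (horner_alg_eigen _ Hay) => /scalk_eq0 /(_ ay0) /eqP.
rewrite horner_prod prodf_seq_eq0 => /hasP [k _ /=].
by rewrite !hornerE subr_eq0 => /eqP; exists k.
Qed.

End Span.
End SingularSpaces.

Section HighestWeight.
Variables (K : numClosedFieldType) (m : nat) (Q : 'I_m.-1 -> K).
Local Notation U := (UslQ Q).
Local Notation H := (Urho Q).

Definition hw_vector (u : 'I_m.-1 -> nat -> K) (M : lmodType U) (v : M) : Prop :=
  [/\ v != 0, forall i t, UX Q true i t *: v = 0
    & forall i t, UJ Q i t *: v = (u i t)%:A *: v].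

Definition cyclic_vector (M : lmodType U) (v : M) : Prop :=
  forall x : M, exists a : U, x = a *: v.

Definition rho_weight (u : 'I_m.-1 -> nat -> K) : K :=
  \sum_(j < m.-1) rho_coef K m j * u j 0%N.

Lemma hw_vector_rho u (M : lmodType U) (v : M) :
  hw_vector u v -> H *: v = (rho_weight u)%:A *: v.
Proof.
move=> [_ _ Jv]; rewrite /Urho scaler_suml /rho_weight scaler_suml scaler_suml.
by apply: eq_bigr => j _; rewrite scalkAl Jv scalkA.
Qed.

Lemma hw_vector_singular u (M : lmodType U) (v : M) : hw_vector u v ->
  singular (fun y => exists c : K, y = c%:A *: v) (rho_weight u).
Proof.
move=> hwv; have [_ Xv Jv] := hwv; split=> [_ [c ->] i t|_ [c ->] i t|_ [c ->]].
- by rewrite scalkC Xv scaler0.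
- by rewrite scalkC Jv; exists (c * u i t); rewrite scalkA.
- by rewrite scalkC (hw_vector_rho hwv) !scalkA mulrC.
Qed.

Section Radical.
Variables (u : 'I_m.-1 -> nat -> K) (M : lmodType U) (v : M).
Hypotheses (hwv : hw_vector u v) (genv : cyclic_vector v).
Local Notation lam := (rho_weight u).

(** [x] has no component for the [H]-eigenvalue [lam]. Killing [x] by a
    polynomial in [H] avoids having to decompose the module into eigenspaces. *)
Let below (x : M) : Prop :=
  exists2 p : {poly K}, p.[lam] != 0 & horner_alg H p *: x = 0.

Let below_add x y : below x -> below y -> below (x + y).
Proof.
move=> [p p0 px] [q q0 qy]; exists (p * q); first by rewrite hornerM mulf_neq0.
rewrite scalerDr [in X in X + _]mulrC !rmorphM -!scalerA px qy !scaler0.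
by rewrite addr0.
Qed.

Let below_scale (c : K) x : below x -> below (c%:A *: x).
Proof. by move=> [p p0 px]; exists p => //; rewrite scalkC px scaler0. Qed.

Lemma hw_decomp x : exists c : K, below (x - c%:A *: v).
Proof.
have below0 : below 0 by exists 1; rewrite ?hornerC ?oner_neq0 ?scaler0.
have [a ->] := genv x.
have [v0 _ _] := hwv; have sing := hw_vector_singular hwv.
have : lower_span (fun y => exists c : K, y = c%:A *: v) (a *: v).
  apply: (lower_spanU sing); apply/lower_span_lowered/lowered0.
  by exists 1; rewrite scalk1.
elim=> [|c k y z _ [b IHy] Yz]; first by exists 0; rewrite scalk0 subr0.
case: k z / Yz => [_ [d ->]|k i t z Yz].
  by exists (b + c * d); rewrite scalkA scalkDl opprD addrACA subrr addr0.
exists b; rewrite addrAC; apply/below_add/below_scale => //.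
have /(lowered_eigen sing) hz := loweredS i t Yz.
exists ('X - (lam - k.+1%:R)%:P); last first.
  by rewrite (horner_alg_eigen _ hz) !hornerE subrr scalk0.
by rewrite !hornerE opprD opprK addrA subrr add0r pnatr_eq0.
Qed.

(** The polynomial killing the lower part of [x] sends [x] itself to a multiple
    of [v], and [v] generates. *)
Lemma proper_below (N : submodClosed M) x :
  proper_submod N -> x \in N -> below x.
Proof.
move=> [y yN] xN; have [c [p p0 px]] := hw_decomp x.
have [c0|c0] := eqVneq c 0; first by exists p; rewrite // -px c0 scalk0 subr0.
move: px; rewrite scalerBr => /eqP; rewrite subr_eq0 => /eqP px.
suff vN : v \in N by have [a yE] := genv y; rewrite yE rpredZ in yN.
rewrite -[v](scalk1 (A := U)) -(mulVf (mulf_neq0 c0 p0)) -!scalkA.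
rewrite -(horner_alg_eigen _ (hw_vector_rho hwv)); apply: rpredZ.
by rewrite -scalkC -px; apply: rpredZ.
Qed.

(** The sum of the proper submodules: the largest submodule all of whose
    elements are [below]. *)
Let rad_pred (x : M) : bool := `[< forall a : U, below (a *: x) >].

Let rad_closed : submod_closed rad_pred.
Proof.
split=> [|c x y /asboolP xR /asboolP yR]; apply/asboolP => a.
  by exists 1; rewrite ?hornerC ?oner_neq0 ?scaler0.
by rewrite scalerDr scalerA; apply: below_add.
Qed.

Let rad_proper : proper_submod (submod_of rad_closed).
Proof.
have [v0 _ _] := hwv; exists v; apply/negP => /asboolP /(_ 1) [p p0].
rewrite scale1r (horner_alg_eigen _ (hw_vector_rho hwv)) => /scalk_eq0.
by move=> /(_ v0) /eqP; rewrite (negPf p0).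
Qed.

Let sub_rad (N : submodClosed M) :
  proper_submod N -> {subset N <= submod_of rad_closed}.
Proof.
move=> propN x xN; apply/asboolP => a; apply: (proper_below propN).
exact: rpredZ.
Qed.

Lemma hw_rad_maximal : maximal_submod (rad_submod M).
Proof.
rewrite /rad_submod; case: pselect => [ex|[]]; first exact: projT2 (cid ex).
by exists (submod_of rad_closed); split=> // N /sub_rad.
Qed.

Lemma hw_sub_rad (N : submodClosed M) :
  proper_submod N -> {subset N <= rad_submod M}.
Proof.
move=> /sub_rad NR x /NR xR; have [propR maxR] := hw_rad_maximal.
by apply: maxR rad_proper _ x xR; apply: sub_rad.
Qed.

(** Each of two generating highest weight vectors is obtained from the other by
    lowering, so they have the same [H]-eigenvalue, and that eigenspace is a
    line. *)
Lemma hw_unique u' (v' : M) : hw_vector u' v' -> cyclic_vector v' ->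
  forall i t, u i t = u' i t.
Proof.
move=> hwv' genv' i t; have [v0 _ Jv] := hwv; have [v'0 _ Jv'] := hwv'.
have low w1 w2 (x1 x2 : M) : hw_vector w1 x1 -> cyclic_vector x1 ->
    hw_vector w2 x2 -> exists k : nat, rho_weight w2 = rho_weight w1 - k%:R.
  move=> hw1 gen1 hw2; have [x20 _ _] := hw2; have [a x2E] := gen1 x2.
  apply: (singular_eigenvalue (hw_vector_singular hw1) (y := x1) (a := a)).
  - by exists 1; rewrite scalk1.
  - by rewrite -x2E.
  - by rewrite -x2E; apply: hw_vector_rho.
have [k k_eq] := low _ _ _ _ hwv genv hwv'.
have [l l_eq] := low _ _ _ _ hwv' genv' hwv.
have weq : rho_weight u' = lam.
  suff /eqP : (k + l)%:R = 0 :> K.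
    by rewrite pnatr_eq0 addn_eq0 k_eq => /andP [/eqP -> _]; rewrite subr0.
  by rewrite natrD -[RHS](subrr lam) {2}l_eq k_eq; ring.
have [c [p p0 px]] := hw_decomp v'.
have v'E : v' = c%:A *: v.
  apply/eqP; rewrite -subr_eq0; apply: contraT => d0.
  suff hd : H *: (v' - c%:A *: v) = lam%:A *: (v' - c%:A *: v).
    by move: px; rewrite (horner_alg_eigen _ hd) => /scalk_eq0 /(_ d0) /eqP;
       rewrite (negPf p0).
  rewrite !scalerBr scalkC (hw_vector_rho hwv) (hw_vector_rho hwv') weq.
  by rewrite !scalkA mulrC.
apply/eqP; rewrite -subr_eq0; apply/eqP/(scalk_eq0 _ v'0).
by rewrite scalkBl -Jv' {1}v'E scalkA mulrC -scalkA -Jv v'E scalkC subrr.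
Qed.

End Radical.
End HighestWeight.

(** * Simple highest weight modules *)

Section SimpleQuotient.
Variables (K : numClosedFieldType) (m : nat) (Q : 'I_m.-1 -> K).
Local Notation U := (UslQ Q).

Definition simple_hw_gen u : simple_hw Q u :=
  quotmod_pi _ (quotmod_pi _ (1 : U^o)).

(** The Verma module is nonzero as soon as its relations lie in some proper left
    ideal [I]; in practice [I] is the annihilator of a highest weight vector in
    a known module. *)
Section Nonzero.
Variables (u : 'I_m.-1 -> nat -> K) (I : submodClosed U^o).
Hypotheses (I1 : 1 \notin I) (relI : forall x, verma_rel u x -> x \in I).

Let vgen : verma Q u := quotmod_pi _ (1 : U^o).

Let vermaE (a : U) : quotmod_pi _ (a : U^o) = a *: vgen.
Proof. by rewrite /vgen -quotmod_piZ; congr quotmod_pi; exact/esym/mulr1. Qed.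

Let verma_gen : cyclic_vector vgen.
Proof. by elim/quotmodW => a; exists a; exact: vermaE. Qed.

Let verma_hw : hw_vector u vgen.
Proof.
split=> [|i t|i t].
- apply/eqP => /quotmod_eq0 /(span_submod_sub relI).
  exact/negP.
- rewrite -vermaE; apply/quotmod_eq0/mem_span_submod.
  by left; exists i, t.
- apply/eqP; rewrite -subr_eq0 -scalerBl -vermaE; apply/eqP/quotmod_eq0.
  by apply/mem_span_submod; right; exists i, t.
Qed.

Lemma simple_hw_simple : simple_mod (simple_hw Q u).
Proof. exact: quotmod_simple (hw_rad_maximal verma_hw verma_gen). Qed.

Lemma simple_hw_cyclic : cyclic_vector (simple_hw_gen u).
Proof.
elim/quotmodW => x; have [a ->] := verma_gen x.
by exists a; rewrite quotmod_piZ.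
Qed.

Lemma simple_hw_hw : hw_vector u (simple_hw_gen u).
Proof.
have [v0 Xv Jv] := verma_hw; split=> [|i t|i t].
- apply/eqP => /quotmod_eq0 radv.
  have [[y yN] _] := hw_rad_maximal verma_hw verma_gen.
  by have [a yE] := verma_gen y; rewrite yE rpredZ in yN.
- by rewrite -quotmod_piZ Xv; apply/quotmod_eq0/rpred0.
- by rewrite -quotmod_piZ Jv quotmod_piZ.
Qed.

(** The image of [I] in the Verma module is a proper submodule, hence lies in
    the radical. *)
Lemma simple_hw_ann a : a \in I -> a *: simple_hw_gen u = 0.
Proof.
move=> aI; rewrite -quotmod_piZ -vermaE; apply/quotmod_eq0.
pose P (x : verma Q u) := `[< exists2 b : U^o, b \in I & x = quotmod_pi _ b >].
have closedP : submod_closed P.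
  split=> [|c x y /asboolP [b bI ->] /asboolP [d dI ->]]; apply/asboolP.
    by exists 0; [apply: rpred0|apply/esym/quotmod_eq0/rpred0].
  exists (c *: b + d); first by rewrite rpredD ?rpredZ.
  by rewrite quotmod_piD quotmod_piZ.
apply: (hw_sub_rad verma_hw verma_gen (N := submod_of closedP)).
  exists vgen; apply/negP => /asboolP [b bI] /eqP.
  rewrite quotmod_piP => /(span_submod_sub relI) bI'.
  by move: I1; rewrite -[1](subrK b) rpredD.
by apply/asboolP; exists a.
Qed.

End Nonzero.

Let annihilator_closed (M : lmodType U) (v : M) :
  submod_closed (fun a : U^o => a *: v == 0 :> M).
Proof.
split=> [|c a b /eqP av /eqP bv]; first by rewrite unfold_in scale0r.
by rewrite unfold_in scalerDl -scalerA av bv scaler0 addr0.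
Qed.

Definition annihilator (M : lmodType U) (v : M) : submodClosed U^o :=
  submod_of (annihilator_closed v).

Lemma annihilatorP (M : lmodType U) (v : M) a :
  a \in annihilator v <-> a *: v = 0.
Proof. by rewrite mem_submod_of; split=> /eqP. Qed.

Section HwVector.
Variables (u : 'I_m.-1 -> nat -> K) (M : lmodType U) (v : M).
Hypothesis hwv : hw_vector u v.

Let ann1 : 1 \notin annihilator v.
Proof. by have [v0 _ _] := hwv; rewrite mem_submod_of /= scale1r. Qed.

Let ann_rel x : verma_rel u x -> x \in annihilator v.
Proof.
have [v0 Xv Jv] := hwv; move=> [[i [t ->]]|[i [t ->]]]; apply/annihilatorP.
  exact: Xv.
by rewrite scalerBl Jv subrr.
Qed.

Lemma simple_mod_cyclic (w : M) : simple_mod M -> w != 0 -> cyclic_vector w.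
Proof.
move=> [_ simpM] w0.
have closedP : submod_closed (fun x : M => `[< exists a : U, x = a *: w >]).
  split=> [|c x y /asboolP [a ->] /asboolP [b ->]]; apply/asboolP.
    by exists 0; rewrite scale0r.
  by exists (c * a + b); rewrite scalerA scalerDl.
have [N0|NT] := simpM (submod_of closedP); last by move=> x; exact/asboolP/NT.
case/eqP: w0; apply: N0; apply/asboolP; exists 1; by rewrite scale1r.
Qed.

(** The annihilator of [v] kills the generator of [simple_hw Q u]; conversely,
    if [a] does not kill [v] then [v = b a v] for some [b], so [a] does not kill
    that generator either. *)
Lemma simple_mod_iso : simple_mod M -> mod_iso M (simple_hw Q u).
Proof.
move=> simpM; have [v0 _ _] := hwv; have genv := simple_mod_cyclic simpM v0.
have [w0 _ _] := simple_hw_hw ann1 ann_rel.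
apply: (cyclic_mod_iso genv (@simple_hw_cyclic u)) => a; split=> [av|aw].
  by apply: (simple_hw_ann ann1 ann_rel); apply/annihilatorP.
apply/eqP; apply: contraT => av0.
have [b vE] := simple_mod_cyclic simpM av0 v.
have : (1 - b * a) *: simple_hw_gen u = 0.
  apply: (simple_hw_ann ann1 ann_rel); apply/annihilatorP.
  by rewrite scalerBl scale1r -scalerA -vE subrr.
by rewrite scalerBl scale1r -scalerA aw scaler0 subr0 => /eqP; rewrite (negPf w0).
Qed.

End HwVector.

Lemma mod_iso_hw_eq u u' (M M' : lmodType U) (v : M) (v' : M') :
  hw_vector u v -> cyclic_vector v -> hw_vector u' v' -> cyclic_vector v' ->
  mod_iso M M' -> forall i t, u i t = u' i t.
Proof.
move=> hwv genv hwv' genv' [f [g fK gK]]; have [v0 Xv Jv] := hwv.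
have hwf : hw_vector u (f v).
  split=> [|i t|i t].
  - by apply: contra v0 => /eqP; rewrite -(raddf0 f) => /(can_inj fK) ->.
  - by rewrite -linearZ Xv raddf0.
  - by rewrite -!linearZ Jv.
apply: (hw_unique hwf _ hwv' genv') => x.
by have [a xE] := genv (g x); exists a; rewrite -linearZ -xE gK.
Qed.

End SimpleQuotient.

(** * Matrix representations *)

Section MatrixBracket.
Variables (K : comNzRingType) (n : nat).

Definition mxbr (A B : 'M[K]_n) : 'M[K]_n := A *m B - B *m A.

Lemma mxbrl a (A B C : 'M[K]_n) : mxbr (a *: A + B) C = a *: mxbr A C + mxbr B C.
Proof.
rewrite /mxbr mulmxDl mulmxDr -scalemxAl -scalemxAr scalerBr.
by apply/matrixP => i j; rewrite !mxE; ring.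
Qed.

Lemma mxbrr a (A B C : 'M[K]_n) : mxbr C (a *: A + B) = a *: mxbr C A + mxbr C B.
Proof.
rewrite /mxbr mulmxDl mulmxDr -scalemxAl -scalemxAr scalerBr.
by apply/matrixP => i j; rewrite !mxE; ring.
Qed.

Lemma mxbr_jacobi (A B C : 'M[K]_n) :
  mxbr A (mxbr B C) + mxbr B (mxbr C A) + mxbr C (mxbr A B) = 0.
Proof.
rewrite /mxbr !(mulmxBl, mulmxBr) !mulmxA.
move: (A *m B *m C) (A *m C *m B) (B *m A *m C) => ABC ACB BAC.
move: (B *m C *m A) (C *m A *m B) (C *m B *m A) => BCA CAB CBA.
by apply/matrixP => i j; rewrite !mxE; ring.
Qed.

Fixpoint lie_eval (T : Type) (g : T -> 'M[K]_n) (x : lie_term K T) : 'M[K]_n :=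
  match x with
  | LGen t => g t
  | LZero => 0
  | LAdd x y => lie_eval g x + lie_eval g y
  | LOpp x => - lie_eval g x
  | LScale a x => a *: lie_eval g x
  | LBr x y => mxbr (lie_eval g x) (lie_eval g y)
  end.

Definition lie_rep (T : Type) (rel : lie_term K T -> lie_term K T -> Prop)
  (g : T -> 'M[K]_n) : Prop := forall x y, rel x y -> lie_eval g x = lie_eval g y.

Lemma lie_eval_eq T rel (g : T -> 'M[K]_n) x y :
  lie_rep rel g -> lie_eq rel x y -> lie_eval g x = lie_eval g y.
Proof.
move=> grel; elim=> //=.
- by move=> ? ? ? _ -> _ ->.
- by move=> ? ? ? ? _ -> _ ->.
- by move=> ? ? _ ->.
- by move=> ? ? ? _ ->.
- by move=> ? ? ? ? _ -> _ ->.
- by move=> *; rewrite addrA.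
- by move=> *; rewrite addrC.
- by move=> *; rewrite add0r.
- by move=> *; rewrite addNr.
- by move=> *; rewrite scalerA.
- by move=> *; rewrite scale1r.
- by move=> *; rewrite scalerDr.
- by move=> *; rewrite scalerDl.
- by move=> *; rewrite mxbrl.
- by move=> *; rewrite mxbrr.
- by move=> *; rewrite /mxbr subrr.
- by move=> *; rewrite mxbr_jacobi.
Qed.

Fixpoint env_eval (L : Type) (f : L -> 'M[K]_n) (x : env_term K L) : 'M[K]_n :=
  match x with
  | EIn x => f x
  | EZero => 0
  | EOne => 1%:M
  | EAdd x y => env_eval f x + env_eval f y
  | EOpp x => - env_eval f x
  | EScale a x => a *: env_eval f x
  | EMul x y => env_eval f x *m env_eval f y
  end.

Lemma env_eval_eq (L : lieAlgType K) (f : L -> 'M[K]_n) x y :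
  (forall a x y, f (a *: x + y) = a *: f x + f y) ->
  (forall x y, f (lie_br x y) = mxbr (f x) (f y)) ->
  env_eq x y -> env_eval f x = env_eval f y.
Proof.
move=> linf brf; elim=> //=.
- by move=> ? ? ? _ -> _ ->.
- by move=> ? ? ? ? _ -> _ ->.
- by move=> ? ? _ ->.
- by move=> ? ? ? _ ->.
- by move=> ? ? ? ? _ -> _ ->.
- by move=> *; rewrite addrA.
- by move=> *; rewrite addrC.
- by move=> *; rewrite add0r.
- by move=> *; rewrite addNr.
- by move=> *; rewrite scalerA.
- by move=> *; rewrite scale1r.
- by move=> *; rewrite scalerDr.
- by move=> *; rewrite scalerDl.
- by move=> *; rewrite mulmxA.
- by move=> *; rewrite mul1mx.
- by move=> *; rewrite mulmx1.
- by move=> *; rewrite mulmxDl.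
- by move=> *; rewrite mulmxDr.
- by move=> *; rewrite scalemxAl.
- by move=> *; rewrite scalemxAr.
Qed.

End MatrixBracket.

Section Realizable.
Variables (K : numClosedFieldType) (m : nat) (Q : 'I_m.-1 -> K).
Local Notation U := (UslQ Q).

(** Evaluation of terms in matrices respects both of the congruences from which
    the enveloping algebra is built. *)
Lemma lie_rep_extend n (g : sl_gen m -> 'M[K]_n) : lie_rep (sl_rel Q) g ->
  exists rho : U -> 'M[K]_n,
    [/\ rho 1 = 1%:M, forall a b, rho (a + b) = rho a + rho b,
        forall c a, rho (c *: a) = c *: rho a,
        forall a b, rho (a * b) = rho a *m rho b
      & (forall b i t, rho (UX Q b i t) = g (genX b i t)) /\
        (forall i t, rho (UJ Q i t) = g (genJ i t))].
Proof.
move=> repg; pose f (x : slQ Q) := lie_eval g (repr x).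
have fE x : f (\pi_(slQ Q)%qT x) = lie_eval g x.
  exact: lie_eval_eq repg (lie_reprP _ x).
have linf a x y : f (a *: x + y) = a *: f x + f y.
  elim/lie_piW: x => x; elim/lie_piW: y => y.
  by rewrite -lie_piZ -lie_piD !fE.
have brf x y : f (lie_br x y) = mxbr (f x) (f y).
  elim/lie_piW: x => x; elim/lie_piW: y => y.
  by have := fE (LBr x y); rewrite -lp_brE => ->; rewrite !fE.
pose rho (a : U) := env_eval f (repr a).
have rhoE x : rho (\pi_(envel (slQ Q))%qT x) = env_eval f x.
  exact: env_eval_eq linf brf (env_reprP x).
exists rho; split=> [|a b|c a|a b|].
- exact: (rhoE EOne).
- elim/env_piW: a => a; elim/env_piW: b => b.
  by have := rhoE (EAdd a b); rewrite -ev_addE => ->; rewrite !rhoE.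
- elim/env_piW: a => a.
  by have := rhoE (EScale c a); rewrite -ev_scaleE => ->; rewrite !rhoE.
- elim/env_piW: a => a; elim/env_piW: b => b.
  by have := rhoE (EMul a b); rewrite -ev_mulE => ->; rewrite !rhoE.
by split=> [b i t|i t]; rewrite [LHS]rhoE /= [LHS]fE.
Qed.

(** The representation may be larger than the submodule generated by [w], as
    usually happens in a tensor product. *)
Definition realizable (u : 'I_m.-1 -> nat -> K) : Prop :=
  exists n (g : sl_gen m -> 'M[K]_n) (w : 'cV[K]_n),
    [/\ lie_rep (sl_rel Q) g, w != 0,
        forall i t, g (genX true i t) *m w = 0
      & forall i t, g (genJ i t) *m w = u i t *: w].

(** A linear dependence between the vectors [rho a *m w] is a linear combination
    of the [a] lying in the annihilator of [w], hence killing the generator of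
    [simple_hw Q u]. *)
Lemma realizable_fin_dim u : realizable u ->
  [/\ simple_mod (simple_hw Q u), cyclic_vector (simple_hw_gen Q u),
      hw_vector u (simple_hw_gen Q u) & fin_dim (simple_hw Q u)].
Proof.
move=> [n [g [w [repg w0 Xw Jw]]]].
have [rho [rho1 rhoD rhoZ rhoM [rhoX rhoJ]]] := lie_rep_extend repg.
have rho0 : rho 0 = 0 by rewrite -(scale0r (0 : U)) rhoZ scale0r.
have closedI : submod_closed (fun a : U^o => rho a *m w == 0).
  split=> [|c a b /eqP aw /eqP bw]; first by rewrite unfold_in rho0 mul0mx.
  by rewrite unfold_in rhoD rhoM mulmxDl -mulmxA aw bw mulmx0 addr0.
have I1 : (1 : U^o) \notin submod_of closedI.
  by rewrite mem_submod_of rho1 mul1mx.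
have relI x : verma_rel u x -> x \in submod_of closedI.
  rewrite mem_submod_of => -[[i [t ->]]|[i [t ->]]].
    by rewrite rhoX Xw.
  rewrite rhoD -scaleN1r !rhoZ rhoJ rho1 mulmxDl Jw scaleN1r mulNmx.
  by rewrite -scalemxAl mul1mx subrr.
split; [exact: simple_hw_simple relI|exact: simple_hw_cyclic|
        exact: simple_hw_hw relI|].
apply: (@dim_le_fin _ _ _ n) => v _.
have /choice [a vE] := fun i => simple_hw_cyclic (v i).
have [d d0 dC] := wide_kernel (\matrix_(i < n.+1, j < n) (rho (a i) *m w) j 0).
exists d => //; under eq_bigr do rewrite vE -scalkAl.
rewrite -scaler_suml; apply: (simple_hw_ann I1 relI).
rewrite mem_submod_of (big_morph rho rhoD rho0).
apply/eqP/matrixP => k l; rewrite (ord1 l) mulmx_suml summxE [RHS]mxE.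
apply: etrans (dC k).
by apply: eq_bigr => j _; rewrite rhoZ -scalemxAl !mxE.
Qed.

End Realizable.

(** * Tensor products and twists *)

Section TensorAction.
Variables (K : comNzRingType) (n1 n2 : nat).

Definition tens_act (A : 'M[K]_n1) (B : 'M[K]_n2) : 'M[K]_(n1 * n2) :=
  A *t 1%:M + 1%:M *t B.

Lemma tens_act_linear a A1 A2 B1 B2 :
  tens_act (a *: A1 + A2) (a *: B1 + B2) = a *: tens_act A1 B1 + tens_act A2 B2.
Proof.
apply/matrixP => i j; case: (mxtens_indexP i) => i1 i2.
by case: (mxtens_indexP j) => j1 j2; rewrite !mxE !mxtens_indexK /= ?mxE; ring.
Qed.

Lemma tens_act_br A1 A2 B1 B2 :
  tens_act (mxbr A1 A2) (mxbr B1 B2) = mxbr (tens_act A1 B1) (tens_act A2 B2).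
Proof.
rewrite /mxbr /tens_act !mulmxDl !mulmxDr !tensmx_mul !mul1mx !mulmx1.
apply/matrixP => i j; case: (mxtens_indexP i) => i1 i2.
case: (mxtens_indexP j) => j1 j2; rewrite !mxE ?mxtens_indexK /= ?mxE.
set x := \sum_j _; set y := \sum_j _; set z := \sum_j _; set t := \sum_j _.
ring.
Qed.

(** [tens_act] is linear and compatible with brackets, so it commutes with the
    evaluation of arbitrary Lie terms and all relations are inherited at once. *)
Lemma lie_eval_tens (T : Type) (g1 : T -> 'M[K]_n1) (g2 : T -> 'M[K]_n2) x :
  lie_eval (fun t => tens_act (g1 t) (g2 t)) x =
  tens_act (lie_eval g1 x) (lie_eval g2 x).
Proof.
have act0 : tens_act 0 0 = 0.
  by have := tens_act_linear (-1) 0 0 0 0; rewrite !scaler0 !addr0 scaleN1r addNr.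
have actD A B C D : tens_act (A + C) (B + D) = tens_act A B + tens_act C D.
  by have := tens_act_linear 1 A C B D; rewrite !scale1r.
have actZ a A B : tens_act (a *: A) (a *: B) = a *: tens_act A B.
  by have := tens_act_linear a A 0 B 0; rewrite act0 !addr0.
elim: x => [t||x IHx y IHy|x IHx|a x IHx|x IHx y IHy] //=.
- by rewrite IHx IHy actD.
- by rewrite IHx -![- lie_eval _ _]scaleN1r actZ scaleN1r.
- by rewrite IHx actZ.
- by rewrite IHx IHy tens_act_br.
Qed.

Lemma lie_rep_tens T rel (g1 : T -> 'M[K]_n1) (g2 : T -> 'M[K]_n2) :
  lie_rep rel g1 -> lie_rep rel g2 ->
  lie_rep rel (fun t => tens_act (g1 t) (g2 t)).
Proof. by move=> rep1 rep2 x y xy; rewrite !lie_eval_tens (rep1 x y) ?(rep2 x y). Qed.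

Lemma tens_act_eigen (A : 'M[K]_n1) (B : 'M[K]_n2) (v : 'cV[K]_n1)
    (w : 'cV[K]_n2) a b :
  A *m v = a *: v -> B *m w = b *: w ->
  tens_act A B *m (v *t w) = (a + b) *: (v *t w).
Proof.
move=> Av Bw; rewrite /tens_act mulmxDl !tensmx_mul !mul1mx Av Bw.
apply/matrixP => i j; case: (mxtens_indexP i) => i1 i2.
by case: (mxtens_indexP j) => j1 j2; rewrite !mxE !mxtens_indexK /= ?mxE; ring.
Qed.

End TensorAction.

Section RealizableWeights.
Variables (K : numClosedFieldType) (m : nat) (Q : 'I_m.-1 -> K).

Lemma realizable_add u1 u2 : realizable Q u1 -> realizable Q u2 ->
  realizable Q (fun i t => u1 i t + u2 i t).
Proof.
move=> [n1 [g1 [w1 [rep1 w10 X1 J1]]]] [n2 [g2 [w2 [rep2 w20 X2 J2]]]].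
exists (n1 * n2)%N, (fun x => tens_act (g1 x) (g2 x)), (w1 *t w2).
split=> [||i t|i t]; first exact: lie_rep_tens.
- have /cV0Pn [i1 wi1] := w10; have /cV0Pn [i2 wi2] := w20.
  apply/eqP => w0; have := tensmxE w1 w2 i1 i2 0 0; rewrite w0 mxE => /esym/eqP.
  by rewrite mulf_eq0 (negPf wi1) (negPf wi2).
- rewrite (tens_act_eigen (a := 0) (b := 0)) ?scale0r ?X1 ?X2 //.
  by rewrite addr0 scale0r.
- exact: tens_act_eigen.
Qed.

(** The one-dimensional module on which the [UJ Q i t] form a geometric
    progression of ratio [1 / Q i], so that J_{i,t} - Q_i J_{i,t+1} vanishes. *)
Lemma realizable_twist (beta : 'I_m.-1 -> K) :
  (forall i, Q i = 0 -> beta i = 0) ->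
  realizable Q (fun i t => (Q i)^-1 ^+ t * beta i).
Proof.
move=> betaQ.
pose g (x : sl_gen m) : 'M[K]_1 :=
  match x with genX _ _ _ => 0 | genJ i t => ((Q i)^-1 ^+ t * beta i)%:M end.
have br0 (A : 'M[K]_1) : mxbr A 0 = 0 by rewrite /mxbr mul0mx mulmx0 subrr.
have br0' (A : 'M[K]_1) : mxbr 0 A = 0 by rewrite /mxbr mul0mx mulmx0 subrr.
exists 1%N, g, 1%:M; split=> [||i t|i t]; last 3 first.
- by rewrite -mxrank_eq0 mxrank1.
- by rewrite /= mul0mx.
- by rewrite /= mulmx1 scale_scalar_mx mulr1.
move=> _ _ [i j s t|b i j s t|i j s t|b i j s t _|b i j s t _|b i j s t u _] /=;
  rewrite ?br0 ?scaler0 //.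
- by rewrite /mxbr -!scalar_mxM mulrC subrr.
- case: eqP => //= _; have [Qi|Qi] := eqVneq (Q i) 0.
    by rewrite Qi betaQ // !mulr0 scale0r subr0 -scalemx1 scale0r.
  by rewrite scale_scalar_mx mulrA exprS mulrA mulfV // mul1r subrr.
Qed.

End RealizableWeights.

(** * Fundamental modules *)

Section WeightedMaps.
Variables (K : comNzRingType) (T : finType).

(** The operator [phi |-> (x |-> c x * phi (s x))] on functions on [T]. *)
Definition wmx (c : T -> K) (s : T -> T) : 'M[K]_#|T| :=
  \matrix_(a, b) (c (enum_val a) * (s (enum_val a) == enum_val b)%:R).

Lemma wmx_mul c d s t :
  wmx c s *m wmx d t = wmx (fun x => c x * d (s x)) (fun x => t (s x)).
Proof.
apply/matrixP => a b; rewrite !mxE (bigD1 (enum_rank (s (enum_val a)))) //=.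
rewrite !mxE enum_rankK eqxx mulr1 big1 ?addr0 ?mulrA // => k.
move=> ks; rewrite mxE (_ : (s _ == _) = false) ?mulr0 ?mul0r //.
by apply: contraNF ks => /eqP ->; rewrite enum_valK.
Qed.

Lemma wmx_ext c d s t : (forall x, c x = d x) ->
  (forall x, c x != 0 -> s x = t x) -> wmx c s = wmx d t.
Proof.
move=> cd st; apply/matrixP => a b; rewrite !mxE -cd.
by have [->|/st ->//] := eqVneq (c (enum_val a)) 0; rewrite !mul0r.
Qed.

Lemma wmx0 c s : (forall x, c x = 0) -> wmx c s = 0.
Proof. by move=> c0; apply/matrixP => a b; rewrite !mxE c0 mul0r. Qed.

Lemma wmxZ a c s : a *: wmx c s = wmx (fun x => a * c x) s.
Proof. by apply/matrixP => i j; rewrite !mxE mulrA. Qed.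

Lemma wmxB c d s : wmx c s - wmx d s = wmx (fun x => c x - d x) s.
Proof. by apply/matrixP => i j; rewrite !mxE mulrBl. Qed.

Definition wcol (x0 : T) : 'cV[K]_#|T| := \col_a (enum_val a == x0)%:R.

Lemma wmx_col c s x0 : (forall x, s x = x0 -> c x = 0) -> wmx c s *m wcol x0 = 0.
Proof.
move=> c0; apply/matrixP => a b; rewrite !mxE (bigD1 (enum_rank x0)) //=.
rewrite !mxE enum_rankK eqxx mulr1 big1 ?addr0 => [|k kx0].
  by case: eqP => [/c0 ->|]; rewrite ?mul0r ?mulr0.
rewrite !mxE (_ : (enum_val k == _) = false) ?mulr0 //.
by apply: contraNF kx0 => /eqP <-; rewrite enum_valK.
Qed.

Lemma wmx_col_id c x0 : wmx c id *m wcol x0 = c x0 *: wcol x0.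
Proof.
apply/matrixP => a b; rewrite !mxE (bigD1 (enum_rank x0)) //=.
rewrite !mxE enum_rankK eqxx mulr1 big1 ?addr0 => [|k kx0].
  by case: eqP => [->|]; rewrite ?mulr0 ?mulr1.
rewrite !mxE (_ : (enum_val k == _) = false) ?mulr0 //.
by apply: contraNF kx0 => /eqP <-; rewrite enum_valK.
Qed.

Lemma wcol_neq0 x0 : wcol x0 != 0.
Proof.
apply/cV0Pn; exists (enum_rank x0); rewrite mxE enum_rankK eqxx oner_eq0 //.
Qed.

End WeightedMaps.

Lemma tperm_disjoint (T : finType) (a b c d x : T) :
  a != c -> a != d -> b != c -> b != d ->
  tperm a b (tperm c d x) = tperm c d (tperm a b x).
Proof.
move=> ac ad bc bd; rewrite -!permM; congr (fun_of_perm _ x).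
by rewrite conjgC tpermJ !tpermD.
Qed.

(** The exterior algebra of the natural module of sl_m has as basis the subsets
    of the [m] coordinates, here the states of a chain of [m] sites, occupied or
    not.  The generator [e_i] moves a particle from site [i + 1] to site [i] and
    [f_i] moves it back.  Moving a particle to a neighbouring site does not
    change the order of the factors in an exterior product, so no sign
    appears. *)
Section SpinChain.
Variables (K : numClosedFieldType) (m : nat).
Local Notation r := m.-1.
Local Notation state := {ffun 'I_r.+1 -> bool}.
Implicit Types (i j : 'I_r) (S : state).

Definition lo i : 'I_r.+1 := widen_ord (leqnSn r) i.
Definition hi i : 'I_r.+1 := lift ord0 i.
(** Operators act on functions of the state, which reverses the direction of
    moves: [can_hop true i S] says that [S] is reached from [hop i S] by moving a
    particle from [hi i] to [lo i]. *)
Definition hop i S : state := [ffun x => S (tperm (lo i) (hi i) x)].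
Definition can_hop b i S : bool := (S (lo i) == b) && (S (hi i) == ~~ b).
Definition occ i S : K := (S (lo i))%:R - (S (hi i))%:R.

Definition chainX b i : 'M[K]_#|{: state}| := wmx (fun S => (can_hop b i S)%:R) (hop i).
Definition chainJ i : 'M[K]_#|{: state}| := wmx (occ i) id.

Lemma lo_hi i : (lo i == hi i) = false.
Proof. by rewrite -val_eqE /= /bump /= ltn_eqF. Qed.

Lemma hop_lo i S : hop i S (lo i) = S (hi i).
Proof. by rewrite ffunE tpermL. Qed.

Lemma hop_hi i S : hop i S (hi i) = S (lo i).
Proof. by rewrite ffunE tpermR. Qed.

Lemma hopD i S x : x != lo i -> x != hi i -> hop i S x = S x.
Proof. by move=> xl xh; rewrite ffunE tpermD // eq_sym. Qed.

Lemma hopK i S : hop i (hop i S) = S.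
Proof. by apply/ffunP => x; rewrite !ffunE tpermK. Qed.

Lemma lo_eq i j : (lo i == lo j) = (i == j).
Proof. by []. Qed.

Lemma hi_eq i j : (hi i == hi j) = (i == j).
Proof. by rewrite (inj_eq lift_inj). Qed.

Lemma lo_eq_hi i j : (lo i == hi j) = (i == j.+1 :> nat).
Proof. by []. Qed.

Lemma chain_JJ i j : mxbr (chainJ i) (chainJ j) = 0.
Proof.
rewrite /mxbr !wmx_mul; apply/eqP; rewrite subr_eq0; apply/eqP.
by apply: wmx_ext => // S; rewrite mulrC.
Qed.

Lemma chain_JX b i j : mxbr (chainJ j) (chainX b i) =
  (if b then cartan K j i else - cartan K j i) *: chainX b i.
Proof.
rewrite /mxbr !wmx_mul wmxB wmxZ; apply: wmx_ext => // S.
case: (boolP (can_hop b i S)) => [/andP [/eqP Slo /eqP Shi]|_]; last first.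
  by rewrite mulr0 mul0r subr0 mulr0.
rewrite mulr1 mul1r mulr1 /occ /cartan /adj_idx.
have [->|ji] := eqVneq j i.
  by rewrite hop_lo hop_hi Slo Shi; case: (b) => /=; ring.
have [jiE|ji1] /= := eqVneq (j : nat) i.+1.
  have <- : hi i = lo j by exact: val_inj.
  rewrite hop_hi (@hopD i S (hi j)) ?hi_eq // ?(eq_sym (hi j)) ?lo_eq_hi.
    by rewrite Slo Shi; case: (b) => /=; ring.
  by rewrite jiE ltn_eqF // ltnW.
have [ijE|ij1] /= := eqVneq (i : nat) j.+1.
  have <- : lo i = hi j by exact: val_inj.
  rewrite hop_lo (@hopD i S (lo j)) ?lo_eq ?lo_eq_hi //.
  by rewrite Slo Shi; case: (b) => /=; ring.
rewrite !hopD ?lo_eq ?lo_eq_hi ?hi_eq ?(eq_sym (hi j)) ?lo_eq_hi //.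
by case: (b); ring.
Qed.

(** Non-adjacent hops involve disjoint pairs of sites. *)
Lemma chain_far b c i j : i != j -> ~~ adj_idx i j ->
  mxbr (chainX b i) (chainX c j) = 0.
Proof.
rewrite /adj_idx negb_or => ij /andP [ji1 ij1].
rewrite /mxbr !wmx_mul; apply/eqP; rewrite subr_eq0; apply/eqP.
apply: wmx_ext => S.
  rewrite /can_hop !hopD ?lo_eq ?hi_eq ?(eq_sym (hi _)) ?lo_eq_hi // 1?eq_sym //.
  exact: mulrC.
move=> _; apply/ffunP => x; rewrite !ffunE tperm_disjoint //.
by rewrite eq_sym lo_eq_hi.
Qed.

Lemma can_hop_hop b i S : can_hop b i (hop i S) = can_hop (~~ b) i S.
Proof. by rewrite /can_hop hop_lo hop_hi andbC negbK. Qed.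

Lemma adj_idxP i j : adj_idx i j -> hi i = lo j \/ hi j = lo i.
Proof. by case/orP => /eqP ij; [left|right]; apply: val_inj. Qed.

(** The two moves compete for the shared site. *)
Lemma can_hop_adj b i j S :
  adj_idx i j -> can_hop b i S && can_hop (~~ b) j (hop i S) = false.
Proof.
move=> /adj_idxP [E|E]; apply/negP => /andP [/andP [/eqP Sl /eqP Sh]].
  by rewrite /can_hop -E hop_hi Sl; case: (b).
by rewrite /can_hop E hop_lo Sh; case: (b); rewrite andbF.
Qed.

Lemma adj_idxC i j : adj_idx i j = adj_idx j i.
Proof. by rewrite /adj_idx orbC. Qed.

Lemma chain_PN i j : mxbr (chainX true i) (chainX false j) =
  if i == j then chainJ i else 0.
Proof.
have [<-|ij] := eqVneq i j.
  have sq b : chainX b i *m chainX (~~ b) i = wmx (fun S => (can_hop b i S)%:R) id.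
    rewrite wmx_mul; apply: wmx_ext => [S|S _]; last exact: hopK.
    by rewrite can_hop_hop negbK -natrM mulnb andbb.
  rewrite /mxbr (sq true) (sq false) wmxB; apply: wmx_ext => // S.
  rewrite /can_hop /occ; case: (S (lo i)); case: (S (hi i));
  by rewrite ?subrr ?subr0 ?sub0r.
have [adj|nadj] := boolP (adj_idx i j); last exact: chain_far.
rewrite /mxbr !wmx_mul !wmx0 ?subrr // => S; rewrite -natrM mulnb.
  by rewrite (can_hop_adj false) // adj_idxC.
by rewrite (can_hop_adj true).
Qed.

Lemma chain_XX b i j : ~~ adj_idx i j -> mxbr (chainX b i) (chainX b j) = 0.
Proof.
by have [<- _|ij] := eqVneq i j; [rewrite /mxbr subrr|apply: chain_far].
Qed.

(** Expanding the double bracket, every term contains a repeated move or a move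
    repeated around a neighbouring one; both are impossible, since the site that
    is not shared is already used. *)
Lemma chain_serre b i j : adj_idx i j ->
  mxbr (chainX b i) (mxbr (chainX b i) (chainX b j)) = 0.
Proof.
move=> /adj_idxP adj.
have sq0 : chainX b i *m chainX b i = 0.
  rewrite wmx_mul wmx0 // => S; rewrite can_hop_hop -natrM mulnb /can_hop.
  by case: (b); case: (S (lo i)); case: (S (hi i)).
have sand0 : chainX b i *m chainX b j *m chainX b i = 0.
  rewrite !wmx_mul wmx0 // => S; rewrite -!natrM !mulnb.
  have [/andP [/eqP Sl /eqP Sh]|//] := boolP (can_hop b i S).
  suff /negPf -> : ~~ can_hop b i (hop j (hop i S)) by rewrite andbF.
  rewrite /can_hop; case: adj => E.
    rewrite hopD ?hop_lo ?Sh; first by case: (b).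
      by rewrite -E lo_hi.
    rewrite lo_eq_hi; have /(congr1 val) /= := E; rewrite /bump /= => <-.
    by rewrite add1n ltn_eqF // ltnW.
  rewrite [hop j _ (hi i)]hopD ?hop_hi ?Sl; first by case: (b); rewrite andbF.
    rewrite eq_sym lo_eq_hi; have /(congr1 val) /= := E; rewrite /bump /= => <-.
    by rewrite add1n ltn_eqF // ltnW.
  by rewrite E eq_sym lo_hi.
rewrite /mxbr mulmxBr mulmxBl !mulmxA sq0 sand0 mul0mx.
by rewrite -mulmxA sq0 mulmx0 !subr0.
Qed.

Variable Q : 'I_m.-1 -> K.

(** The image in sl_m[x] of the generators, evaluated at [x = a]. *)
Definition fundamental a (x : sl_gen m) : 'M[K]_#|{: state}| :=
  match x with
  | genX b i t => (a ^+ t * (if b then 1 else 1 - Q i * a)) *: chainX b i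
  | genJ i t => a ^+ t *: chainJ i
  end.

Lemma mxbrZ n (a b : K) (A B : 'M[K]_n) :
  mxbr (a *: A) (b *: B) = (a * b) *: mxbr A B.
Proof.
rewrite /mxbr -!scalemxAl -!scalemxAr !scalerA scalerBr.
by rewrite [b * a]mulrC.
Qed.

Lemma fundamental_rep a : lie_rep (sl_rel Q) (fundamental a).
Proof.
move=> _ _ [i j s t|b i j s t|i j s t|b i j s t ij|b i j s t _|b i j s t u ij] /=;
  rewrite !mxbrZ.
- by rewrite chain_JJ scaler0.
- by rewrite chain_JX !scalerA exprD mulrC mulrA.
- rewrite chain_PN; case: eqP => [<-|_] /=; last by rewrite scaler0.
  by rewrite scalerA -scalerBl; congr (_ *: _); rewrite exprS exprD; ring.
- by rewrite chain_XX // scaler0.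
- by rewrite !exprS; congr (_ *: _); ring.
- by rewrite chain_serre // scaler0.
Qed.

(** The highest weight vector of the [k]-th exterior power is the state in which
    the first sites are occupied, up to and including [lo k]. *)
Lemma realizable_fundamental k a :
  realizable Q (fun i t => (i == k)%:R * a ^+ t).
Proof.
pose S0 : state := [ffun x : 'I_r.+1 => (x <= k)%N].
exists #|{: state}|, (fundamental a), (wcol K S0).
split=> [||i t|i t]; first exact: fundamental_rep.
- exact: wcol_neq0.
- rewrite /= -scalemxAl wmx_col ?scaler0 // => S SE.
  suff -> : can_hop true i S = false by [].
  rewrite -(hopK i S) can_hop_hop SE /can_hop !ffunE /= /bump /= add1n.
  by case: ltnP => ik; rewrite ?andbF // (ltnW ik).
- rewrite /= -scalemxAl wmx_col_id scalerA mulrC; congr (_ * _ *: _).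
  rewrite /occ !ffunE /= /bump /= add1n -val_eqE /=.
  by case: ltngtP; rewrite ?subrr ?subr0.
Qed.

End SpinChain.

(** * The rank one analysis *)

Section PolynomialCurrents.
Variables (K : comNzRingType).

(** The linear extension of [x^t |-> f t]. It turns the families of generators
    into operators indexed by polynomials, in which the relations are
    [K[x]]-bilinear. *)
Definition plin (V : lmodType K) (f : nat -> V) (p : {poly K}) : V :=
  \sum_(t < size p) p`_t *: f t.

Lemma plin_wide (V : lmodType K) (f : nat -> V) (p : {poly K}) n :
  (size p <= n)%N -> plin f p = \sum_(t < n) p`_t *: f t.
Proof.
move=> pn; rewrite /plin (big_ord_widen n (fun t => p`_t *: f t)) // big_mkcond.
apply: eq_bigr => t _; case: ltnP => // /(nth_default 0) ->.
by rewrite scale0r.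
Qed.

Lemma plin_is_linear (V : lmodType K) (f : nat -> V) : linear (plin f).
Proof.
move=> a p q; pose n := maxn (size (a *: p + q)) (maxn (size p) (size q)).
rewrite !(@plin_wide _ f _ n) ?leq_max ?leqnn ?orbT // scaler_sumr -big_split /=.
by apply: eq_bigr => t _; rewrite coefD coefZ scalerDl scalerA.
Qed.

HB.instance Definition _ (V : lmodType K) (f : nat -> V) :=
  GRing.isLinear.Build K {poly K} V _ (plin f) (plin_is_linear f).

Lemma plinZ (V : lmodType K) (f : nat -> V) a p : plin f (a *: p) = a *: plin f p.
Proof. exact: linearZ. Qed.

Lemma plinXn (V : lmodType K) (f : nat -> V) t : plin f 'X^t = f t.
Proof.
rewrite (@plin_wide _ _ _ t.+1) ?size_polyXn // big_ord_recr /= big1 => [|s _].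
  by rewrite add0r coefXn eqxx scale1r.
by rewrite coefXn ltn_eqF // scale0r.
Qed.

Lemma plin_sum (V : lmodType K) (f : nat -> V) (p g : {poly K}) :
  plin f (p * g) = \sum_(s < size p) p`_s *: plin f ('X^s * g).
Proof.
rewrite -{1}[p]coefK poly_def mulr_suml linear_sum.
by apply: eq_bigr => s _; rewrite -scalerAl linearZ.
Qed.

(** A relation that holds on monomials extends by bilinearity. *)
Lemma plin_commute (A : algType K) (f g h : nat -> A) (d : {poly K}) :
  (forall s t, f s * g t = g t * f s + plin h (d * 'X^(s + t))) ->
  forall a b, plin f a * plin g b = plin g b * plin f a + plin h (d * (a * b)).
Proof.
move=> fg a b.
have fgb s : f s * plin g b = plin g b * f s + plin h (d * ('X^s * b)).
  have -> : d * ('X^s * b) = b * (d * 'X^s) by ring.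
  rewrite plin_sum mulr_sumr mulr_suml -big_split; apply: eq_bigr => t _ /=.
  rewrite -scalerAr fg scalerDr -scalerAl; congr (_ + _ *: plin h _).
  by rewrite exprD; ring.
have -> : d * (a * b) = a * (d * b) by ring.
rewrite plin_sum mulr_suml mulr_sumr -big_split; apply: eq_bigr => s _ /=.
rewrite -scalerAl fgb scalerDr -scalerAr; congr (_ + _ *: plin h _).
by ring.
Qed.

End PolynomialCurrents.

Section RankOne.
Variables (K : numClosedFieldType) (m : nat) (Q : 'I_m.-1 -> K).
Local Notation U := (UslQ Q).

Definition PX b i : {poly K} -> U := plin (UX Q b i).
Definition PJ i : {poly K} -> U := plin (UJ Q i).
Local Notation twist i := (1 - (Q i)%:P * 'X).

Lemma PXD b i p q : PX b i (p + q) = PX b i p + PX b i q.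
Proof. exact: raddfD. Qed.

Lemma PXZ b i c p : PX b i (c *: p) = c *: PX b i p.
Proof. exact: plinZ. Qed.

Lemma PXXn b i t : UX Q b i t = PX b i 'X^t.
Proof. by rewrite /PX plinXn. Qed.

Lemma PJXn i t : UJ Q i t = PJ i 'X^t.
Proof. by rewrite /PJ plinXn. Qed.

Lemma PJX b i j a c : PJ j a * PX b i c =
  PX b i c * PJ j a +
  PX b i ((if b then cartan K j i else - cartan K j i)%:P * (a * c)).
Proof.
apply: plin_commute => s t; rewrite UJX mul_polyC linearZ /=.
by rewrite plinXn.
Qed.

Lemma PXX i j a c : PX true i a * PX false j c =
  PX false j c * PX true i a + (if i == j then PJ i (twist i * (a * c)) else 0).
Proof.
case: eqP => [<-|ij].
  apply: plin_commute => s t; rewrite UXX eqxx mulrBl mul1r linearB /= plinXn.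
  by rewrite -mulrA -exprS mul_polyC plinZ plinXn addnC.
have := @plin_commute K U (UX Q true i) (UX Q false j) (fun=> 0) 0 _ a c.
rewrite mul0r raddf0; apply=> s t.
by rewrite UXX mul0r raddf0; case: eqP.
Qed.

Lemma PXC b i a c : PX b i a * PX b i c = PX b i c * PX b i a.
Proof.
have := @plin_commute K U (UX Q b i) (UX Q b i) (fun=> 0) 0 _ a c.
rewrite mul0r raddf0 addr0; apply=> s t.
by rewrite UXC mul0r raddf0 addr0.
Qed.

Lemma PrhoX i a : Urho Q * PX false i a = PX false i a * Urho Q - PX false i a.
Proof.
rewrite /PX /plin mulr_sumr mulr_suml -sumrB; apply: eq_bigr => t _.
by rewrite -scalerAr UrhoX scalerDr scalerAl scaleN1r scalerN.
Qed.

Section Module.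
Variables (u : 'I_m.-1 -> nat -> K) (M : lmodType U) (v : M).
Hypotheses (hwv : hw_vector u v) (finM : fin_dim M).
Variable i : 'I_m.-1.
Local Notation w := (plin (u i : nat -> K^o)).
Local Notation d := (twist i).

Lemma PJv a : PJ i a *: v = (w a)%:A *: v.
Proof.
have [_ _ Jv] := hwv; rewrite /PJ /plin scaler_suml scaler_suml scaler_suml.
by apply: eq_bigr => t _; rewrite scalkAl Jv scalkA.
Qed.

Lemma PXv j a : PX true j a *: v = 0.
Proof.
have [_ Xv _] := hwv; rewrite /PX /plin scaler_suml big1 // => t _.
by rewrite scalkAl Xv scaler0.
Qed.

(** The polynomials [p] with this property form an ideal. *)
Definition kills (p : {poly K}) : Prop := forall g, PX false i (p * g) *: v = 0.

(** The value in question is read off by applying X^+_i(1) to the zero vector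
    X^-_i(p g) v. *)
Lemma kills_weight p : kills p -> forall g, w (d * (p * g)) = 0.
Proof.
move=> kp g; have [v0 _ _] := hwv; apply: (scalk_eq0 _ v0 (A := U)).
have := PXX i i 1 (p * g); rewrite eqxx mul1r -PJv => /(congr1 (fun x => x *: v)).
by rewrite scalerDl -!scalerA kp PXv !scaler0 add0r.
Qed.

(** A linear dependence between the X^-_{i,t} v gives [p]; bracketing with
    J_i(g) then produces the multiples of [p]. *)
Lemma exists_kills : exists2 p, p != 0 & kills p.
Proof.
have [n dep] := fin_dim_le finM.
have [c [k ck] cv] := dep (fun t => UX Q false i t *: v) (fun=> I).
pose p := \poly_(t < n.+1) c (inord t).
have pv : PX false i p *: v = 0.
  rewrite /PX (@plin_wide _ _ _ _ n.+1) ?size_poly // scaler_suml -[RHS]cv.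
  by apply: eq_bigr => t _; rewrite scalkAl coef_poly ltn_ord inord_val.
exists p.
  apply/eqP => /(congr1 (fun q : {poly K} => q`_k)).
  by rewrite coef0 coef_poly ltn_ord inord_val => /eqP; apply/negP.
move=> g; have := PJX false i i ((- 2^-1)%:P * g) p.
move=> /(congr1 (fun x => x *: v)); rewrite scalerDl -!scalerA pv scaler0 PJv scalkC.
rewrite pv scaler0 add0r /cartan eqxx => ->; congr (PX _ _ _ *: _).
rewrite !mulrA -polyCM mulrNN mulfV ?pnatr_eq0 // mul1r; exact: mulrC.
Qed.

(** [E = PX true i a] and [F = PX false i b] behave on the vectors [F^r v] like
    part of a standard triple of sl_2 if [c = 1], of the Heisenberg algebra if
    [c = 0]: [E F^(r+1) v = (r + 1) (l - c r) F^r v]. In finite dimension some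
    [F^r v] vanishes, and for the least such [r] the coefficient must be 0. *)
Lemma rank_one p a b (c : K) : kills p ->
  p %| d * (a * b) * b - c *: b -> exists k : nat, w (d * (a * b)) = c * k%:R.
Proof.
move=> kp /dvdpP [e eE]; set l := w _.
pose F r := PX false i b ^+ r *: v.
have kF g r : PX false i (p * g) *: F r = 0.
  elim: r => [|r IHr]; first by rewrite /F expr0 scale1r.
  by rewrite /F exprS -scalerA scalerA PXC -scalerA IHr scaler0.
have FS r : F r.+1 = PX false i b *: F r by rewrite /F exprS -scalerA.
have HF r : PJ i (d * (a * b)) *: F r = (l - 2 * c * r%:R)%:A *: F r.
  elim: r => [|r IHr]; first by rewrite /F expr0 scale1r PJv mulr0 subr0.
  rewrite FS scalerA PJX scalerDl -scalerA IHr scalkC /cartan eqxx.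
  have -> : (- 2)%:P * (d * (a * b) * b) = (- (2 * c)) *: b + p * ((- 2)%:P * e).
    rewrite -[d * (a * b) * b](subrK (c *: b)) eE -!mul_polyC !polyCN polyCM.
    by ring.
  rewrite PXD [(PX _ _ _ + _) *: _]scalerDl kF addr0 PXZ [X in _ + X]scalkAl.
  by rewrite -scalkDl -natr1; congr (_%:A *: _); ring.
have EF r : PX true i a *: F r.+1 = (r.+1%:R * (l - c * r%:R))%:A *: F r.
  elim: r => [|r IHr].
    rewrite FS scalerA PXX eqxx scalerDl -scalerA /F expr0 scale1r PXv scaler0.
    by rewrite add0r PJv mul1r mulr0 subr0.
  rewrite FS scalerA PXX eqxx scalerDl -scalerA IHr HF scalkC -FS -scalkDl.
  by congr (_%:A *: _); rewrite -!natr1; ring.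
have [r0 Fr0] : exists r, F r = 0.
  pose mu r : K := u i 0%N - 2 * r%:R.
  apply: (fin_dim_eigen0 (h := UJ Q i 0) (mu := mu)) finM _ _ => [r s|r].
    have two0 : 2 != 0 :> K by rewrite pnatr_eq0.
    by move=> /addrI /oppr_inj /(mulfI two0) /eqP; rewrite eqr_nat => /eqP.
  have -> : UJ Q i 0 = PJ i 1 by rewrite PJXn expr0.
  elim: r => [|r IHr].
    rewrite /F expr0 scale1r PJv -(expr0 'X) plinXn /mu mulr0 subr0 //.
  rewrite FS scalerA PJX scalerDl -scalerA IHr scalkC mul1r mul_polyC.
  rewrite PXZ [X in _ + X]scalkAl -scalkDl /cartan eqxx /mu -natr1.
  by congr (_%:A *: _); ring.
have exF : exists r, F r == 0 by exists r0; apply/eqP.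
case: (ex_minnP exF) => -[|r] /eqP Fr minr.
  by have [/eqP + _ _] := hwv; rewrite -[v](scale1r) -(expr0 (PX false i b)).
exists r; have := EF r; rewrite Fr scaler0 => /esym /scalk_eq0.
have Fr0' : F r != 0 by apply: contraTneq (leqnn r.+1) => /eqP /minr; rewrite -ltnNge.
move=> /(_ Fr0') /eqP; rewrite mulf_eq0 pnatr_eq0 /= subr_eq0.
by move=> /eqP.
Qed.

(** The vectors [PX false i (p g) v] form a singular space of degree one below
    that of [v]. If it were nonzero it would generate the module, which would
    then not contain [v]. *)
Lemma weight_kills p : simple_mod M -> (forall g, w (d * (p * g)) = 0) -> kills p.
Proof.
move=> simpM wp g; apply/eqP; apply: contraT => y0.
pose Y (y : M) := exists g, y = PX false i (p * g) *: v.
have singY : singular Y (rho_weight u - 1).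
  split=> [_ [f ->] j t|_ [f ->] j t|_ [f ->]].
  - rewrite PXXn scalerA PXX scalerDl -scalerA PXv scaler0 add0r.
    case: eqP => [->|_]; last by rewrite scale0r.
    by rewrite (mulrCA 'X^t) PJv wp scalk0.
  - have [_ _ Jv] := hwv; exists (u j t *: f + (- cartan K j i) *: ('X^t * f)).
    rewrite {1}PJXn scalerA PJX scalerDl -scalerA -PJXn Jv scalkC.
    have -> : p * (u j t *: f + - cartan K j i *: ('X^t * f)) =
              u j t *: (p * f) + (- cartan K j i) *: ('X^t * (p * f)).
      by rewrite mulrDr -!scalerAr [p * (_ * f)]mulrCA.
    rewrite PXD scalerDl mul_polyC; congr (_ + _).
    by rewrite PXZ [RHS]scalkAl.
  - rewrite scalerA PrhoX scalerBl -scalerA (hw_vector_rho hwv) scalkC.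
    by rewrite scalkBl scalk1.
have [v0 _ _] := hwv; have [a vE] := simple_mod_cyclic simpM y0 v.
have := singular_eigenvalue singY (y := PX false i (p * g) *: v) (a := a)
  (nu := rho_weight u).
rewrite -vE => /(_ (ex_intro _ g erefl) v0 (hw_vector_rho hwv)) [k lamE].
have /eqP : k.+1%:R = 0 :> K.
  by rewrite -natr1 -[RHS](subrr (rho_weight u)) {2}lamE; ring.
by rewrite pnatr_eq0.
Qed.

Hypothesis simpM : simple_mod M.

(** Take [p] of least degree among the polynomials with [kills p]. For a root
    [z] of [p], let [pz] be [p / (x - z)] up to a constant. If
    [(1 - Q x) pz] vanished at [z], then [p] would divide
    [(1 - Q x) a pz^2] for all [a] and [rank_one] with [c = 0] would give
    [kills pz]. So it does not vanish, and [rank_one] with [c = 1] applies to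
    [b = pz] and [a] constant. The [pz] are an interpolation basis modulo
    [p]. *)
Lemma weight_current : exists (rs : seq K) (n : K -> nat),
  [/\ uniq rs, forall z, z \in rs -> d.[z] != 0
    & forall g, w (d * g) = \sum_(z <- rs) (n z)%:R * (d * g).[z]].
Proof.
have exsz : exists k, `[< exists2 p : {poly K}, p != 0 /\ size p = k & kills p >].
  by have [p p0 kp] := exists_kills; exists (size p); apply/asboolP; exists p.
case: (ex_minnP exsz) => k /asboolP [p [p0 szp] kp] minp.
have [rs pE] := closed_field_poly_normal p.
pose pz z := \prod_(y <- rem z rs) ('X - y%:P).
have pzE z : z \in rs -> p %= ('X - z%:P) * pz z.
  move=> zrs; rewrite pE (perm_big _ (perm_to_rem zrs)) big_cons /=.
  by rewrite eqp_scale ?lead_coef_eq0.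
have pz0 z : pz z != 0 by apply/monic_neq0/monic_prod_XsubC.
have dpz z : z \in rs -> (d * pz z).[z] != 0.
  move=> zrs; apply/negP => /factor_theorem [e eE].
  have kpz : kills (pz z).
    apply: weight_kills => // a.
    have [|l] := @rank_one p a (pz z) 0 kp; last by rewrite mul0r [pz z * a]mulrC.
    rewrite scale0r subr0 (eqp_dvdl _ (pzE z zrs)).
    have -> : d * (a * pz z) * pz z = a * e * (('X - z%:P) * pz z).
      by transitivity (d * pz z * (a * pz z)); [ring|rewrite eE; ring].
    exact: dvdp_mull.
  have := minp (size (pz z)); rewrite asboolT; last by exists (pz z).
  move=> /(_ isT); rewrite -szp (eqp_size (pzE z zrs)) size_Mmonic.
  - by rewrite size_XsubC /= ltnn.
  - by rewrite polyXsubC_eq0.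
  - exact: monic_prod_XsubC.
have urs : uniq rs.
  apply: count_mem_uniq => z; case: (boolP (z \in rs)) => zrs; last exact/count_memPn.
  have := dpz z zrs; rewrite hornerM mulf_eq0 negb_or => /andP [_].
  rewrite -rootE root_prod_XsubC => /count_memPn.
  rewrite count_rem zrs /= eqxx => /eqP; rewrite subn_eq0 => le1.
  by apply/eqP; rewrite eqn_leq le1 -has_count has_pred1.
have intz z : exists l : nat, z \in rs -> w (d * pz z) = l%:R * (d * pz z).[z].
  case: (boolP (z \in rs)) => zrs; last by exists 0%N.
  have dz0 := dpz z zrs; pose a := ((d * pz z).[z]^-1)%:P.
  have [|l lE] := @rank_one p a (pz z) 1 kp.
    rewrite scale1r (eqp_dvdl _ (pzE z zrs)).
    have -> : d * (a * pz z) * pz z - pz z = (d * pz z * a - 1) * pz z by ring.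
    apply: dvdp_mul => //; rewrite dvdp_XsubCl rootE hornerD hornerN hornerM.
    by rewrite !hornerC mulfV ?subrr.
  exists l => _; move: lE; rewrite mulrCA [a * _]mul_polyC plinZ mul1r => <-.
  by rewrite -[_ *: _]/(_ * _) mulrAC mulVf // mul1r.
have /choice [n nE] := intz.
exists rs, n; split=> // [z zrs|g].
  by have := dpz z zrs; rewrite hornerM mulf_eq0 negb_or => /andP [].
pose h := g - \sum_(z <- rs) (g.[z] / (pz z).[z]) *: pz z.
have pzz z : z \in rs -> (pz z).[z] != 0.
  by move=> /dpz; rewrite hornerM mulf_eq0 negb_or => /andP [].
have hrs : all (root h) rs.
  apply/allP => z zrs; rewrite rootE /h !hornerE horner_sum (bigD1_seq z) //=.
  rewrite hornerZ divfK ?pzz // big_seq_cond big1 ?addr0 ?subrr // => y /andP [yrs yz].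
  rewrite hornerZ; suff /eqP -> : (pz y).[z] == 0 by rewrite mulr0.
  by rewrite -rootE root_prod_XsubC mem_rem_uniq // !inE zrs eq_sym yz.
have /dvdpP [e eE] : p %| h.
  rewrite pE dvdpZl ?lead_coef_eq0 //; apply: uniq_roots_dvdp => //.
  by rewrite uniq_rootsE.
have : w (d * h) = 0 by rewrite eE [e * p]mulrC kills_weight.
rewrite /h mulrBr raddfB /= => /eqP; rewrite subr_eq0 => /eqP ->.
rewrite mulr_sumr raddf_sum /= big_seq [RHS]big_seq; apply: eq_bigr => z zrs.
rewrite -scalerAr plinZ nE // hornerM [in RHS]hornerM -[_ *: _]/(_ * _).
have := pzz z zrs; move: (pz z).[z] => x x0; by field.
Qed.

(** The difference between [w] and the evaluations at the roots of [phi]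
    vanishes on the multiples of [1 - Q x]. If [Q = 0] these are all
    polynomials; otherwise the difference is a multiple [beta] of the evaluation
    at [1 / Q]. *)
Lemma weight_param : exists phib : {poly K} * K,
  [/\ in_monicQ (Q i) phib.1, in_BQ (Q i) phib.2
    & forall t, u i t = \sum_(z <- poly_roots phib.1) z ^+ t +
                        (Q i)^-1 ^+ t * phib.2].
Proof.
have [rs [n [urs drs wE]]] := weight_current.
pose s := flatten [seq nseq (n z) z | z <- rs].
have sum_s (f : K -> K) : \sum_(z <- s) f z = \sum_(z <- rs) (n z)%:R * f z.
  rewrite big_flatten big_map; apply: eq_bigr => z _.
  by rewrite big_nseq iter_addr_0 mulr_natl.
pose phi := \prod_(z <- s) ('X - z%:P).
have roots_phi : perm_eq (poly_roots phi) s.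
  apply: prod_XsubC_eq; rewrite /poly_roots.
  case: closed_field_poly_normal => r /= phiE.
  rewrite -[RHS]/phi phiE; have /monicP -> := monic_prod_XsubC s xpredT id.
  by rewrite scale1r.
have wX t : u i t = w 'X^t by rewrite plinXn.
have sumE t : \sum_(z <- poly_roots phi) z ^+ t = \sum_(z <- rs) (n z)%:R * z ^+ t.
  by rewrite (perm_big _ roots_phi) sum_s.
have dE z : d.[z] = 1 - Q i * z by rewrite !hornerE.
have phi_root z : z \in s -> z \in rs.
  by move=> /flatten_mapP [y yrs]; rewrite mem_nseq => /andP [_ /eqP ->].
pose beta := if Q i == 0 then 0 else u i 0%N - \sum_(z <- rs) (n z)%:R.
exists (phi, beta); split=> [|Qi|t] /=.
- split=> [|Qi]; first exact: monic_prod_XsubC.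
  rewrite root_prod_XsubC; apply/negP => /phi_root /drs.
  by rewrite dE mulfV // subrr eqxx.
- by rewrite /beta Qi eqxx.
- rewrite sumE /beta; case: eqP => [Qi|/eqP Qi].
    rewrite mulr0 addr0 wX; have := wE 'X^t; rewrite Qi mul0r subr0 mul1r => ->.
    by apply: eq_bigr => z _; rewrite hornerXn.
  have /factor_theorem [e eE] : root ('X^t - ((Q i)^-1 ^+ t)%:P) (Q i)^-1.
    by rewrite rootE !hornerE subrr.
  have QV : ((Q i)^-1)%:P * (Q i)%:P = 1 by rewrite -polyCM mulVf.
  have dE' : 'X^t - ((Q i)^-1 ^+ t)%:P = d * (- ((Q i)^-1)%:P * e).
    rewrite eE -[in LHS](mul1r 'X).
    transitivity (e * (((Q i)^-1)%:P * (Q i)%:P * 'X - ((Q i)^-1)%:P)); last by ring.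
    by rewrite QV.
  have wXt : w 'X^t = w ('X^t - ((Q i)^-1 ^+ t)%:P) + (Q i)^-1 ^+ t * u i 0%N.
    by rewrite raddfB /= -alg_polyC plinZ -(expr0 'X) !plinXn -[_ *: _]/(_ * _) subrK.
  rewrite wX wXt dE' wE -dE'.
  under eq_bigr do rewrite !hornerE mulrBr.
  by rewrite sumrB -mulr_suml; ring.
Qed.

End Module.
End RankOne.

(** * Classification *)

Section Classification.
Variables (K : numClosedFieldType) (m : nat) (Q : 'I_m.-1 -> K).
Local Notation U := (UslQ Q).

(** If every nonzero vector could be raised, an eigenvector of [Urho] would give
    nonzero eigenvectors for infinitely many eigenvalues. The vectors killed by
    all raising operators are stable under the commuting [UJ]. *)
Lemma exists_hw_vector (M : lmodType U) : simple_mod M -> fin_dim M ->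
  exists u v, @hw_vector K m Q u M v.
Proof.
move=> [[x0 x00] _] finM; have [n dep] := fin_dim_le finM.
have [|||mu [x [_ x_neq0 Hx]]] :=
  exists_eigenvector (h := Urho Q) dep _ _ _ I x00; try by [].
have [y y0 Xy] : exists2 y : M, y != 0 & forall i t, UX Q true i t *: y = 0.
  apply: contrapT => noy.
  have up k : exists y : M, y != 0 /\ Urho Q *: y = (mu + k%:R)%:A *: y.
    elim: k => [|k [y [y0 Hy]]]; first by exists x; rewrite addr0.
    have [[i t] Xy] : exists it : 'I_m.-1 * nat, UX Q true it.1 it.2 *: y != 0.
      apply: contrapT => /forallNP all0; apply: noy; exists y => // i t.
      by apply/eqP; have /negP := all0 (i, t); rewrite negbK.
    exists (UX Q true i t *: y); split => //.
    rewrite scalerA UrhoX scalerDl -scalerA Hy scalkC [X in _ + X]scalkAl.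
    by rewrite -scalkDl -natr1 addrA.
  have /choice [w wP] := up.
  have [||k wk] := fin_dim_eigen0 (h := Urho Q) (mu := fun k => mu + k%:R)
    (w := w) finM.
  - by move=> k l /addrI /eqP; rewrite eqr_nat => /eqP.
  - by move=> k; have [] := wP k.
  - by have [] := wP k; rewrite wk eqxx.
pose S (z : M) := forall i t, UX Q true i t *: z = 0.
have [|||||z [Sz z0] Jz] := commuting_eigenvector
    (h := fun it : 'I_m.-1 * nat => UJ Q it.1 it.2) (S := S) (n := n) _ _ _ _ _ Xy y0.
- by move=> it js z _; rewrite !scalerA UJJ.
- by move=> w _; apply: dep.
- move=> [j s] z Sz i t /=; have := UJX Q true i j s t.
  move=> /(congr1 (fun a => a *: z)); rewrite scalerDl -!scalerA Sz scaler0.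
  by rewrite scalkAl Sz scaler0 addr0 => /esym.
- by move=> a z Sz i t; rewrite scalkC Sz scaler0.
- by move=> a b Sa Sb i t; rewrite scalerDr Sa Sb addr0.
have /choice [u uE] := Jz.
by exists (fun i t => u (i, t)), z; split=> // i t; rewrite (uE (i, t)).
Qed.

(** The case distinctions in [uQ] disappear with the conventions [0 ^+ 0 = 1]
    and [0^-1 = 0]. *)
Lemma uQE (pb : 'I_m.-1 -> {poly K} * K) : param Q pb -> forall i t,
  uQ Q pb i t = \sum_(z <- poly_roots (pb i).1) z ^+ t + (Q i)^-1 ^+ t * (pb i).2.
Proof.
move=> parpb i t; have [[monphi _] _] := parpb i.
rewrite /uQ; case: t => [|t] /=.
  under eq_bigr do rewrite expr0.
  rewrite expr0 mul1r big_const_seq count_predT iter_addr_0; congr (_%:R + _).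
  rewrite /poly_roots; case: closed_field_poly_normal => rs /= phiE.
  rewrite {1}phiE (monicP monphi) scale1r size_prod_XsubC.
  by [].
congr (_ + _); case: eqP => [->|_]; last by rewrite exprVn.
by rewrite invr0 expr0n mul0r.
Qed.

Lemma realizable_sum (T : Type) (s : seq T) (F : T -> 'I_m.-1 -> nat -> K) :
  (forall x, realizable Q (F x)) -> realizable Q (fun i t => \sum_(x <- s) F x i t).
Proof.
move=> realF; elim: s => [|x s IHs].
  rewrite (_ : (fun i t => _) = fun i t => (Q i)^-1 ^+ t * 0).
    exact: realizable_twist.
  by apply: funext => i; apply: funext => t; rewrite big_nil mulr0.
rewrite (_ : (fun i t => _) = fun i t => F x i t + \sum_(x <- s) F x i t).
  exact: realizable_add.
by apply: funext => i; apply: funext => t; rewrite big_cons.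
Qed.

Lemma realizable_uQ (pb : 'I_m.-1 -> {poly K} * K) :
  param Q pb -> realizable Q (uQ Q pb).
Proof.
move=> parpb.
rewrite (_ : uQ Q pb = fun i t =>
    \sum_(k : 'I_m.-1) \sum_(z <- poly_roots (pb k).1) (i == k)%:R * z ^+ t
    + (Q i)^-1 ^+ t * (pb i).2).
  apply: realizable_add.
    apply: realizable_sum => k; apply: realizable_sum => z.
    exact: realizable_fundamental.
  by apply: (@realizable_twist _ _ _ (fun i => (pb i).2)) => i; have [] := parpb i.
apply: funext => i; apply: funext => t; rewrite uQE //; congr (_ + _).
rewrite (bigD1 i) //= eqxx [X in _ + X]big1 ?addr0 => [|k ki].
  by apply: eq_bigr => z _; rewrite mul1r.
by apply: big1 => z _; rewrite eq_sym (negPf ki) mul0r.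
Qed.

(** Both sides extend to combinations of evaluations of an arbitrary polynomial.
    A polynomial vanishing at all relevant points but [z] compares the
    multiplicities of [z]. The point [q^-1] does not interfere: for [q != 0] it
    is a root of neither polynomial, and for [q = 0] it has coefficient 0. *)
Lemma param_inj (q : K) (phi phi' : {poly K}) (beta beta' : K) :
  in_monicQ q phi -> in_monicQ q phi' -> in_BQ q beta -> in_BQ q beta' ->
  (forall t, \sum_(z <- poly_roots phi) z ^+ t + q^-1 ^+ t * beta =
             \sum_(z <- poly_roots phi') z ^+ t + q^-1 ^+ t * beta') ->
  (phi, beta) = (phi', beta').
Proof.
move=> [monphi rphi] [monphi' rphi'] Bb Bb' eqt.
have phiE (psi : {poly K}) :
    psi \is monic -> psi = \prod_(z <- poly_roots psi) ('X - z%:P).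
  move=> /monicP monpsi; rewrite /poly_roots.
  case: closed_field_poly_normal => rs /= {1}->.
  by rewrite monpsi scale1r.
have rootsP (psi : {poly K}) z : psi \is monic -> (z \in poly_roots psi) = root psi z.
  by move=> /phiE {2}->; rewrite root_prod_XsubC.
have eqp (p : {poly K}) : \sum_(z <- poly_roots phi) p.[z] + p.[q^-1] * beta =
                          \sum_(z <- poly_roots phi') p.[z] + p.[q^-1] * beta'.
  have expand (s : seq K) b : \sum_(z <- s) p.[z] + p.[q^-1] * b =
      \sum_(t < size p) p`_t * (\sum_(z <- s) z ^+ t + q^-1 ^+ t * b).
    under [RHS]eq_bigr do rewrite mulrDr mulr_sumr mulrA.
    rewrite big_split /= exchange_big /= -mulr_suml; congr (_ + _ * _).
      by apply: eq_bigr => z _; rewrite horner_coef.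
    exact: horner_coef.
  by rewrite !expand; apply: eq_bigr => t _; rewrite eqt.
have perm_roots : perm_eq (poly_roots phi) (poly_roots phi').
  apply/allP => z _ /=; set s := poly_roots phi; set s' := poly_roots phi'.
  have [/andP [q0 /eqP zq]|] := boolP ((q != 0) && (z == q^-1)).
    rewrite zq !(count_memPn _) ?rootsP //; [exact: rphi'|exact: rphi].
  rewrite negb_and negbK => zq.
  pose others := [seq y <- q^-1 :: s ++ s' | y != z].
  pose p := \prod_(y <- others) ('X - y%:P).
  have pz : p.[z] != 0.
    by rewrite -rootE root_prod_XsubC mem_filter eqxx.
  have py y : y \in q^-1 :: s ++ s' -> y != z -> p.[y] = 0.
    by move=> yin yz; apply/eqP; rewrite -rootE root_prod_XsubC mem_filter yz.
  have sum_p r : {subset r <= s ++ s'} ->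
      \sum_(y <- r) p.[y] = (count_mem z r)%:R * p.[z].
    move=> rs; rewrite (bigID (pred1 z)) /= [X in _ + X]big_seq_cond.
    rewrite [X in _ + X]big1 ?addr0 => [|y /andP [/rs yr yz]]; last first.
      by rewrite py // inE yr orbT.
    rewrite (eq_bigr (fun=> p.[z])) => [|y /eqP ->//].
    by rewrite big_const_seq iter_addr_0 mulr_natl.
  have qb : p.[q^-1] * beta = p.[q^-1] * beta'.
    case/orP: zq => [/eqP q0|zq]; first by rewrite (Bb q0) (Bb' q0).
    by rewrite py ?mul0r // ?inE ?eqxx // eq_sym.
  have := eqp p; rewrite qb => /addIr; rewrite !sum_p => [/(mulIf pz) /eqP||].
  - by rewrite eqr_nat.
  - by move=> y ys; rewrite mem_cat ys orbT.
  - by move=> y ys; rewrite mem_cat ys.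
have -> : phi = phi'.
  by rewrite (phiE _ monphi) (phiE _ monphi') (perm_big _ perm_roots).
congr (_, _); have := eqt 0%N; rewrite (perm_big _ perm_roots) => /addrI.
by rewrite !expr0 !mul1r.
Qed.

End Classification.

Theorem theorem6p4 (R : realType) (m : nat) (m_gt0 : (0 < m)%N)
    (Q : 'I_m.-1 -> R[i]) :
  [/\ forall pb : 'I_m.-1 -> {poly R[i]} * R[i], param Q pb ->
        [/\ simple_mod (simple_hw Q (uQ Q pb)),
            highest_weight_mod (uQ Q pb) (simple_hw Q (uQ Q pb))
          & fin_dim (simple_hw Q (uQ Q pb))],
      forall pb pb' : 'I_m.-1 -> {poly R[i]} * R[i],
        param Q pb -> param Q pb' ->
        (mod_iso (simple_hw Q (uQ Q pb)) (simple_hw Q (uQ Q pb')) <-> pb = pb')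
    & forall M : lmodType (UslQ Q), simple_mod M -> fin_dim M ->
        exists2 pb : 'I_m.-1 -> {poly R[i]} * R[i],
          param Q pb & mod_iso M (simple_hw Q (uQ Q pb))].
Proof.
split=> [pb parpb|pb pb' parpb parpb'|M simpM finM].
- have [simpL genL [v0 Xv Jv] finL] := realizable_fin_dim (realizable_uQ parpb).
  by split=> //; exists (simple_hw_gen Q (uQ Q pb)).
- split=> [isoL|<-]; last by exists idfun, idfun.
  have [_ genL hwL _] := realizable_fin_dim (realizable_uQ parpb).
  have [_ genL' hwL' _] := realizable_fin_dim (realizable_uQ parpb').
  have ueq := mod_iso_hw_eq hwL genL hwL' genL' isoL.
  apply: funext => i; rewrite [pb i]surjective_pairing [pb' i]surjective_pairing.
  have [mon B] := parpb i; have [mon' B'] := parpb' i.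
  by apply: param_inj mon mon' B B' _ => t; rewrite -!uQE.
- have [u [v hwv]] := exists_hw_vector simpM finM.
  have /choice [pb pbP] := fun i => weight_param hwv finM i simpM.
  have parpb : param Q pb by move=> i; have [] := pbP i.
  exists pb => //; rewrite (_ : uQ Q pb = u); first exact: simple_mod_iso hwv simpM.
  apply: funext => i; apply: funext => t; rewrite uQE //.
  by have [_ _ ->] := pbP i.
Qed.
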